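(* Let $k>15$ be an integer. Then the zeros $\theta\in[\pi/10,9\pi/10]$ of the functions $\theta\mapsto F_{2k-1}(z_\theta)$ and $\theta\mapsto F_{2k+1}(z_\theta)$ lie in $I_{2k-1}$ and $I_{2k+1}$ respectively. In fact, each interval $I_{j,2k-1}$ contained in $[\pi/10,9\pi/10]$ contains an odd number of zeros (counted with multiplicity) of $\theta\mapsto F_{2k-1}(z_\theta)$, and each interval $I_{j,2k+1}$ contained in $[\pi/10,9\pi/10]$ contains an odd number of zeros (counted with multiplicity) of $\theta\mapsto F_{2k+1}(z_\theta)$. Moreover, the intervals $I_{j,2k-1}$ and $I_{i,2k+1}$ that are contained in $[\pi/10,9\pi/10]$ are pairwise disjoint, and the intervals $I_{j,2k-1}$ are separated by the intervals $I_{i,2k+1}$: between any two distinct intervals $I_{j,2k-1}$, $I_{j',2k-1}$ contained in $[\pi/10,9\pi/10]$ there lies an interval $I_{i,2k+1}$.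
   Context: $\mathbb{H}$ is the complex upper half-plane. For $\gamma=\begin{pmatrix} a&b\\c&d\end{pmatrix}\in \mathrm{SL}_2(\mathbb{Z})$, the weight $m$ slash operator is $(f|_m\gamma)(z)=(cz+d)^{-m}f\left(\frac{az+b}{cz+d}\right)$. For odd $d$ let $\chi(d)=1$ if $d\equiv1\pmod4$ and $\chi(d)=-1$ if $d\equiv3\pmod 4$. For an odd integer $m\ge3$ define $$E_{m,\chi}(z)=\frac12\sum_{\substack{(c,d)\equiv(0,1)\ (\mathrm{mod}\ 2)\\ \gcd(c,d)=1}}\chi(d)(cz+d)^{-m},\qquad z\in\mathbb{H},$$ and $G_m=E_{m,\chi}|_m\gamma_0$ with $\gamma_0=\begin{pmatrix}1&-1\\1&0\end{pmatrix}$. Let $\gamma_1=\begin{pmatrix}0&-1\\1&0\end{pmatrix}$, and for $\theta\in(0,\pi)$ let $z_\theta=\frac12e^{i\theta}-\frac12\in\mathbb{H}$. Define $$F_m(z_\theta)=(e^{-i\theta/2})^{-m}\,(G_m|_m\gamma_1)(z_\theta)=e^{im\theta/2}\,z_\theta^{-m}\,G_m(-1/z_\theta).$$ For an integer $k>15$ put $\alpha_{j,k}=\frac{2\pi j}{2k-1}$, $$I_{j,2k-1}=\left(\alpha_{j,k}-\frac{2\pi}{(2k+1)(2k-1)},\ \alpha_{j,k}+\frac{2\pi}{(2k+1)(2k-1)}\right)\quad (j=0,\dots,k-1),$$ and $I_{2k-1}=\bigcup_{j}I_{j,2k-1}$. The intervals $I_{j,2k+1}$ ($j=0,\dots,k$)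 and $I_{2k+1}$ are given by the same definitions with $k$ replaced by $k+1$; thus $I_{j,2k+1}$ is centred at $\frac{2\pi j}{2k+1}$ with half-width $\frac{2\pi}{(2k+3)(2k+1)}$. *)

(* Defs.v *)
From Stdlib Require Export Reals ZArith List Arith.
From Coquelicot Require Export Coquelicot.

Open Scope R_scope.

Definition Csum_list {I : Type} (f : I -> C) (s : list I) : C :=
  fold_right (fun i acc => (f i + acc)%C) (RtoC 0) s.

(* Finite subsets of [I], as duplicate-free lists, directed by inclusion. *)
Definition finite_subsets (I : Type) (P : list I -> Prop) : Prop :=
  exists s0 : list I, forall s : list I, NoDup s -> incl s0 s -> P s.

Definition is_Csum {I : Type} (f : I -> C) (l : C) : Prop :=
  filterlim (Csum_list f) (finite_subsets I) (locally l).

(* Total operator in the style of [RInt]; meaningful when the family is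
   summable, i.e. absolutely summable. *)
Definition Csum {I : Type} (f : I -> C) : C :=
  iota (T := C_R_CompleteNormedModule) (is_Csum f).

Record SL2Z := mkSL2Z {
  sl_a : Z; sl_b : Z; sl_c : Z; sl_d : Z;
  sl_det : (sl_a * sl_d - sl_b * sl_c = 1)%Z
}.

Definition slash (m : nat) (f : C -> C) (g : SL2Z) (z : C) : C :=
  (/ ((IZR (sl_c g) * z + IZR (sl_d g)) ^ m) *
   f ((IZR (sl_a g) * z + IZR (sl_b g)) / (IZR (sl_c g) * z + IZR (sl_d g))))%C.

Definition gamma0 : SL2Z := mkSL2Z 1 (-1) 1 0 eq_refl.
Definition gamma1 : SL2Z := mkSL2Z 0 (-1) 1 0 eq_refl.

(* [Z.modulo] by 4 takes values in {0,1,2,3}, also for negative [d]; the value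
   at even [d] is never used. *)
Definition chi (d : Z) : R :=
  if (d mod 4 =? 1)%Z then 1 else if (d mod 4 =? 3)%Z then -1 else 0.

Definition E_index (p : Z * Z) : bool :=
  (Z.even (fst p) && Z.odd (snd p) && (Z.gcd (fst p) (snd p) =? 1)%Z)%bool.

Definition E (m : nat) (z : C) : C :=
  (/ 2 * Csum (fun p : Z * Z =>
     if E_index p
     then chi (snd p) * / ((IZR (fst p) * z + IZR (snd p)) ^ m)
     else 0))%C.

Definition G (m : nat) : C -> C := slash m (E m) gamma0.

Definition expi (t : R) : C := (cos t, sin t).

Definition z_ (theta : R) : C := (/ 2 * expi theta - / 2)%C.

(* theta |-> F_m(z_theta) *)
Definition F (m : nat) (theta : R) : C :=
  (/ (expi (- theta / 2) ^ m) * slash m (G m) gamma1 (z_ theta))%C.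

(* [f] vanishes at [x] to order exactly [n] (order 0 meaning [f x <> 0]).  Such
   an [n] is unique, and for [f] smooth at [x] it is the order of the first
   derivative of [f] that is nonzero at [x]. *)
Definition has_order (f : R -> C) (x : R) (n : nat) : Prop :=
  exists g : R -> C,
    continuous g x /\ g x <> RtoC 0 /\
    locally x (fun t => f t = (RtoC (t - x) ^ n * g t)%C).

(* [f] has finitely many zeros in [A], and their multiplicities add up to [N];
   [s] lists the zeros with their multiplicities. *)
Definition number_of_zeros (f : R -> C) (A : R -> Prop) (N : nat) : Prop :=
  exists s : list (R * nat),
    NoDup (map fst s) /\
    (forall x : R, In x (map fst s) <-> A x /\ f x = RtoC 0) /\
    (forall (x : R) (n : nat), In (x, n) s -> has_order f x n) /\
    N = list_sum (map snd s).

(* [Ival k j] is I_{j,2k-1}, and [Ival (k + 1) j] is I_{j,2k+1}. *)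
Definition alpha (j k : nat) : R := 2 * PI * INR j / (2 * INR k - 1).

Definition Ival (k j : nat) (theta : R) : Prop :=
  let r := 2 * PI / ((2 * INR k + 1) * (2 * INR k - 1)) in
  alpha j k - r < theta < alpha j k + r.

Definition Iunion (k : nat) (theta : R) : Prop :=
  exists j : nat, (j < k)%nat /\ Ival k j theta.

Definition range (theta : R) : Prop := PI / 10 <= theta <= 9 * PI / 10.

Definition contained (A B : R -> Prop) : Prop := forall x : R, A x -> B x.

Definition disjoint (A B : R -> Prop) : Prop := forall x : R, ~ (A x /\ B x).

Definition left_of (A B : R -> Prop) : Prop :=
  forall x y : R, A x -> B y -> x < y.

(* Main.v *)
Require Import Defs.
From Stdlib Require Import Lra Lia Psatz Permutation Classical Ranalysis5.

(** Since [gamma0 gamma1 = - (1 1; 0 1)], [F m theta] is, with [t = theta / 2] and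
    [a = c + d], half the sum of [chi d / (- a cos t + i d sin t)^m] over coprime
    odd [a, d].  The change of sign of [d] shows that the sum is purely imaginary.
    The four pairs with [|a| = |d| = 1] add up to [- 2 i sin (m t)], whose zeros
    are the centres [alpha].  For [m >= 31] the sum of the other terms is smaller
    than [2 sin (PI / (m + 2))], the value of the main term at the end points of
    the intervals; this locates the zeros and gives a change of sign in each
    interval.  The same majorant shows that the other terms have Lipschitz constant
    at most [0.925 m], less than the slope of the main term on the intervals.
    Hence each interval contains exactly one zero, and that zero is simple. *)

(** * Unordered sums of real families *)

(** The critical case is [m = 31]. With [m = 31 + 2 n], every term outside the main four is bounded
    by a constant times [(/ 1.19) ^ n], because [a^2 cos^2 t + d^2 sin^2 t >= 1.19] for the
    remaining pairs as long as [theta] keeps a distance 0.31 from 0 and [PI]. The end-point value of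
    the main term decays only like [1 / n]. At [n = 0] the comparison is about 0.152 against 0.190,
    so the constants leave little room.

    Multiplicity is a factorisation with a cofactor continuous at the zero. Accordingly the series
    is not differentiated: the difference quotients of its terms are summed. By the mean value
    theorem they obey the bounds of the derivatives, and uniform domination makes their sum
    continuous at the base point. A cofactor without zeros on the whole interval then yields
    uniqueness and simplicity together.

    Convergence along finite subsets is absolute convergence, so everything reduces to real families
    dominated by a nonnegative family with bounded finite sums. *)

Definition Rsum {I : Type} (f : I -> R) (s : list I) : R :=
  fold_right (fun i acc => f i + acc) 0 s.

Definition is_Rsum {I : Type} (f : I -> R) (l : R) : Prop :=
  forall eps, 0 < eps -> exists s0 : list I,
    forall s, NoDup s -> incl s0 s -> Rabs (Rsum f s - l) < eps.

(** For a nonnegative family this is summability with total at most [B], stated without naming a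
    limit. *)
Definition sum_le {I : Type} (f : I -> R) (B : R) : Prop :=
  forall s, NoDup s -> Rsum f s <= B.

Lemma NoDup_same_elements {I : Type} (s : list I) :
  exists s', NoDup s' /\ forall x, In x s' <-> In x s.
Proof.
  induction s as [|a s [s' [H1 H2]]].
  - exists nil; split; [constructor | intros; tauto].
  - destruct (classic (In a s)) as [Ha|Ha].
    + exists s'; split; [easy|]. intros x; simpl; rewrite H2.
      split; [tauto | intros [<-|?]; tauto].
    + exists (a :: s'); split.
      * constructor; [now rewrite H2 | easy].
      * intros x; simpl; rewrite H2; tauto.
Qed.

(** Splits a finite sum into its part over [s0] and a rest; the monotonicity and tail estimates rest
    on this. *)
Lemma incl_Permutation_app {I : Type} (s0 s : list I) :
  NoDup s0 -> incl s0 s -> exists r, Permutation s (s0 ++ r).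
Proof.
  revert s; induction s0 as [|a s0 IH]; intros s H0 Hi.
  - exists s; apply Permutation_refl.
  - inversion H0 as [|? ? Ha Hs0]; subst.
    destruct (in_split a s (Hi a (in_eq _ _))) as [l1 [l2 ->]].
    destruct (IH (l1 ++ l2) Hs0) as [r Hr].
    { intros x Hx. specialize (Hi x (in_cons _ _ _ Hx)).
      rewrite in_app_iff in *; simpl in Hi.
      destruct Hi as [|[->|]]; tauto. }
    exists r. simpl. rewrite <- Hr.
    apply Permutation_sym, Permutation_middle.
Qed.

Lemma Rsum_ext {I : Type} (f g : I -> R) (s : list I) :
  (forall i, f i = g i) -> Rsum f s = Rsum g s.
Proof. intros H; induction s; simpl; [easy | now rewrite H, IHs]. Qed.

Lemma Rsum_le {I : Type} (f g : I -> R) (s : list I) :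
  (forall i, f i <= g i) -> Rsum f s <= Rsum g s.
Proof. intros H; induction s; simpl; [lra | specialize (H a); lra]. Qed.

Lemma Rsum_zero {I : Type} (f : I -> R) (s : list I) :
  (forall i, In i s -> f i = 0) -> Rsum f s = 0.
Proof.
  induction s as [|a s IH]; simpl; intros H; [easy|].
  rewrite IH by (intros; apply H; now right).
  rewrite (H a) by now left. ring.
Qed.

Lemma Rsum_plus {I : Type} (f g : I -> R) (s : list I) :
  Rsum (fun i => f i + g i) s = Rsum f s + Rsum g s.
Proof. induction s; simpl; lra. Qed.

Lemma Rsum_scal {I : Type} c (f : I -> R) (s : list I) :
  Rsum (fun i => c * f i) s = c * Rsum f s.
Proof. induction s; simpl; lra. Qed.

Lemma Rsum_app {I : Type} (f : I -> R) (s1 s2 : list I) :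
  Rsum f (s1 ++ s2) = Rsum f s1 + Rsum f s2.
Proof. induction s1; simpl; lra. Qed.

Lemma Rsum_perm {I : Type} (f : I -> R) (s1 s2 : list I) :
  Permutation s1 s2 -> Rsum f s1 = Rsum f s2.
Proof. induction 1; simpl; lra. Qed.

Lemma Rsum_abs {I : Type} (f : I -> R) (s : list I) :
  Rabs (Rsum f s) <= Rsum (fun i => Rabs (f i)) s.
Proof.
  induction s; simpl; [rewrite Rabs_R0; lra|].
  eapply Rle_trans; [apply Rabs_triang | lra].
Qed.

Lemma Rsum_nonneg {I : Type} (f : I -> R) (s : list I) :
  (forall i, 0 <= f i) -> 0 <= Rsum f s.
Proof. intros H; induction s; simpl; [lra | specialize (H a); lra]. Qed.

Lemma Rsum_incl {I : Type} (f : I -> R) (s0 s : list I) :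
  (forall i, 0 <= f i) -> NoDup s0 -> incl s0 s -> Rsum f s0 <= Rsum f s.
Proof.
  intros Hf H0 Hi. destruct (incl_Permutation_app s0 s H0 Hi) as [r Hr].
  rewrite (Rsum_perm _ _ _ Hr), Rsum_app.
  pose proof (Rsum_nonneg f r Hf); lra.
Qed.

Lemma Rsum_diff_le {I : Type} (f b : I -> R) (s0 s : list I) :
  (forall i, Rabs (f i) <= b i) -> NoDup s0 -> incl s0 s ->
  Rabs (Rsum f s - Rsum f s0) <= Rsum b s - Rsum b s0.
Proof.
  intros Hf H0 Hi. destruct (incl_Permutation_app s0 s H0 Hi) as [r Hr].
  rewrite !(Rsum_perm _ _ _ Hr), !Rsum_app.
  replace (Rsum f s0 + Rsum f r - Rsum f s0) with (Rsum f r) by ring.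
  replace (Rsum b s0 + Rsum b r - Rsum b s0) with (Rsum b r) by ring.
  eapply Rle_trans; [apply Rsum_abs | now apply Rsum_le].
Qed.

Lemma sum_le_sup {I : Type} (f : I -> R) B :
  (forall i, 0 <= f i) -> sum_le f B ->
  exists M, sum_le f M /\
    forall eps, 0 < eps -> exists s, NoDup s /\ M - eps < Rsum f s.
Proof.
  intros Hf HB.
  destruct (completeness (fun r => exists s, NoDup s /\ r = Rsum f s))
    as [M [HM1 HM2]].
  - exists B. intros r [s [Hs ->]]. now apply HB.
  - exists 0, nil. split; [constructor | easy].
  - exists M. split.
    + intros s Hs. apply HM1. now exists s.
    + intros eps He. apply NNPP. intros Hn.
      assert (M <= M - eps); [|lra].
      apply HM2. intros r [s [Hs ->]].
      apply Rnot_lt_le. intros Hlt. apply Hn. now exists s.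
Qed.

Lemma is_Rsum_ext {I : Type} (f g : I -> R) l :
  (forall i, f i = g i) -> is_Rsum f l -> is_Rsum g l.
Proof.
  intros H Hf eps He. destruct (Hf eps He) as [s0 H0]. exists s0.
  intros s Hs Hi. rewrite <- (Rsum_ext f g s H). now apply H0.
Qed.

Lemma is_Rsum_plus {I : Type} (f g : I -> R) l l' :
  is_Rsum f l -> is_Rsum g l' -> is_Rsum (fun i => f i + g i) (l + l').
Proof.
  intros Hf Hg eps He.
  destruct (Hf (eps / 2)) as [s0 H0]; [lra|].
  destruct (Hg (eps / 2)) as [s1 H1]; [lra|].
  exists (s0 ++ s1). intros s Hs Hi. rewrite Rsum_plus.
  apply incl_app_inv in Hi.
  specialize (H0 s Hs (proj1 Hi)). specialize (H1 s Hs (proj2 Hi)).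
  replace (_ - _) with ((Rsum f s - l) + (Rsum g s - l')) by ring.
  eapply Rle_lt_trans; [apply Rabs_triang | lra].
Qed.

Lemma is_Rsum_scal {I : Type} c (f : I -> R) l :
  is_Rsum f l -> is_Rsum (fun i => c * f i) (c * l).
Proof.
  intros Hf eps He.
  assert (Hc : 0 < Rabs c + 1) by (pose proof (Rabs_pos c); lra).
  destruct (Hf (eps / (Rabs c + 1))) as [s0 H0].
  { now apply Rdiv_lt_0_compat. }
  exists s0. intros s Hs Hi. specialize (H0 s Hs Hi).
  rewrite Rsum_scal.
  replace (c * Rsum f s - c * l) with (c * (Rsum f s - l)) by ring.
  rewrite Rabs_mult.
  apply Rle_lt_trans with ((Rabs c) * (eps / (Rabs c + 1))).
  - apply Rmult_le_compat_l; [apply Rabs_pos | lra].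
  - apply Rmult_lt_reg_r with (Rabs c + 1); [easy|].
    field_simplify; lra.
Qed.

Lemma is_Rsum_unique {I : Type} (f : I -> R) l l' :
  is_Rsum f l -> is_Rsum f l' -> l = l'.
Proof.
  intros H H'. apply NNPP. intros Hn.
  assert (He : 0 < Rabs (l - l') / 2).
  { assert (0 < Rabs (l - l')) by (apply Rabs_pos_lt; lra). lra. }
  destruct (H _ He) as [s0 H0]. destruct (H' _ He) as [s1 H1].
  destruct (NoDup_same_elements (s0 ++ s1)) as [s [Hs Hin]].
  assert (Hi : incl (s0 ++ s1) s) by (intros x Hx; now apply Hin).
  apply incl_app_inv in Hi.
  specialize (H0 s Hs (proj1 Hi)). specialize (H1 s Hs (proj2 Hi)).
  rewrite <- Rabs_Ropp in H0.
  assert (Rabs (l - l') < Rabs (l - l')); [|lra].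
  replace (l - l') with (- (Rsum f s - l) + (Rsum f s - l')) at 1 by ring.
  eapply Rle_lt_trans; [apply Rabs_triang | lra].
Qed.

Lemma is_Rsum_ex_pos {I : Type} (f : I -> R) B :
  (forall i, 0 <= f i) -> sum_le f B -> exists l, is_Rsum f l.
Proof.
  intros Hf HB. destruct (sum_le_sup f B Hf HB) as [M [HM1 HM2]].
  exists M. intros eps He. destruct (HM2 eps He) as [s0 [H0 H1]].
  exists s0. intros s Hs Hi.
  pose proof (Rsum_incl f s0 s Hf H0 Hi). specialize (HM1 s Hs).
  apply Rabs_def1; lra.
Qed.

(** Both [b + f] and [b] are nonnegative with bounded finite sums, so each converges to its
    supremum, and [f] is their difference. *)
Lemma is_Rsum_ex {I : Type} (f b : I -> R) B :
  (forall i, Rabs (f i) <= b i) -> sum_le b B -> exists l, is_Rsum f l.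
Proof.
  intros Hf HB.
  destruct (is_Rsum_ex_pos (fun i => b i + f i) (2 * B)) as [l Hl].
  - intros i. specialize (Hf i). apply Rabs_le_between in Hf. lra.
  - intros s Hs. apply Rle_trans with (Rsum (fun i => 2 * b i) s).
    + apply Rsum_le. intros i. specialize (Hf i).
      apply Rabs_le_between in Hf. lra.
    + rewrite Rsum_scal. specialize (HB s Hs). lra.
  - destruct (is_Rsum_ex_pos b B) as [l' Hl']; [|easy|].
    { intros i. eapply Rle_trans; [apply Rabs_pos | apply Hf]. }
    exists (l + -1 * l').
    apply is_Rsum_ext with (fun i => (b i + f i) + -1 * b i);
      [intros; ring|].
    apply is_Rsum_plus; [easy | now apply is_Rsum_scal].
Qed.

Lemma is_Rsum_abs_le {I : Type} (f b : I -> R) B l :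
  (forall i, Rabs (f i) <= b i) -> sum_le b B -> is_Rsum f l -> Rabs l <= B.
Proof.
  intros Hf HB Hl. apply Rnot_lt_le. intros Hn.
  destruct (Hl (Rabs l - B)) as [s0 H0]; [lra|].
  destruct (NoDup_same_elements s0) as [s [Hs Hin]].
  specialize (H0 s Hs (fun x Hx => proj2 (Hin x) Hx)).
  pose proof (Rabs_triang_inv l (Rsum f s)) as H1.
  rewrite Rabs_minus_sym in H1.
  pose proof (Rsum_abs f s). specialize (HB s Hs).
  pose proof (Rsum_le (fun i => Rabs (f i)) b s Hf). lra.
Qed.

Lemma is_Rsum_involution {I : Type} (f : I -> R) l (sigma : I -> I) :
  (forall i, sigma (sigma i) = i) ->
  is_Rsum f l -> is_Rsum (fun i => f (sigma i)) l.
Proof.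
  intros Hs Hf eps He. destruct (Hf eps He) as [s0 H0].
  exists (map sigma s0). intros s Hn Hi.
  replace (Rsum _ s) with (Rsum f (map sigma s)).
  - apply H0.
    + apply FinFun.Injective_map_NoDup; [|easy].
      intros x y H. now rewrite <- (Hs x), H.
    + intros x Hx. rewrite <- (Hs x).
      apply in_map, Hi, in_map, Hx.
  - clear. induction s; simpl; [easy | now rewrite IHs].
Qed.

Lemma is_Rsum_finite {I : Type} (f : I -> R) (s0 : list I) :
  NoDup s0 -> (forall i, ~ In i s0 -> f i = 0) -> is_Rsum f (Rsum f s0).
Proof.
  intros H0 Hf eps He. exists s0. intros s Hs Hi.
  destruct (incl_Permutation_app s0 s H0 Hi) as [r Hr].
  rewrite (Rsum_perm _ _ _ Hr), Rsum_app, (Rsum_zero f r).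
  - rewrite Rplus_0_r, Rminus_diag, Rabs_R0. easy.
  - intros i Hir. apply Hf. intros Hi0.
    apply (Permutation_NoDup Hr) in Hs.
    apply in_split in Hi0. destruct Hi0 as [l1 [l2 ->]].
    rewrite <- app_assoc in Hs. simpl in Hs.
    apply NoDup_remove_2 in Hs. apply Hs.
    rewrite !in_app_iff. tauto.
Qed.

Lemma continuous_Rsum {I : Type} (f : I -> R -> R) (s : list I) x :
  (forall i, continuous (f i) x) ->
  continuous (fun t => Rsum (fun i => f i t) s) x.
Proof.
  intros H. induction s; simpl.
  - apply continuous_const.
  - apply (continuous_plus (f a) (fun t => Rsum (fun i => f i t) s));
      [apply H | easy].
Qed.

(** Weierstrass M-test: a finite [s0] carries all but [eps / 4] of the total of [b], so near [x] the
    sum differs from a finite, continuous sum by at most [eps / 4]. *)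
Lemma continuous_is_Rsum {I : Type} (f : I -> R -> R) (b : I -> R) B
  (S : R -> R) x :
  sum_le b B ->
  locally x (fun t => (forall i, Rabs (f i t) <= b i) /\
                      is_Rsum (fun i => f i t) (S t)) ->
  (forall i, continuous (f i) x) ->
  continuous S x.
Proof.
  intros HB HU Hc.
  assert (Hb : forall i, 0 <= b i).
  { intros i. eapply Rle_trans; [apply Rabs_pos|].
    apply (locally_singleton _ _ HU). }
  destruct (sum_le_sup b B Hb HB) as [M [HM1 HM2]].
  apply filterlim_locally. intros eps.
  assert (He : 0 < eps / 4) by (destruct eps; simpl; lra).
  destruct (HM2 _ He) as [s0 [H0 HM0]].
  assert (Htail : forall t, (forall i, Rabs (f i t) <= b i) ->
    is_Rsum (fun i => f i t) (S t) ->
    Rabs (S t - Rsum (fun i => f i t) s0) <= eps / 4).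
  { intros t Ht Hst. apply Rnot_lt_le. intros Hlt.
    destruct (Hst (Rabs (S t - Rsum (fun i => f i t) s0) - eps / 4))
      as [s1 H1]; [lra|].
    destruct (NoDup_same_elements (s0 ++ s1)) as [s [Hs Hin]].
    assert (Hi : incl (s0 ++ s1) s) by (intros y Hy; now apply Hin).
    apply incl_app_inv in Hi. specialize (H1 s Hs (proj2 Hi)).
    pose proof (Rsum_diff_le (fun i => f i t) b s0 s Ht H0 (proj1 Hi)) as H2.
    specialize (HM1 s Hs).
    rewrite Rabs_minus_sym in H1.
    pose proof (Rabs_triang (S t - Rsum (fun i => f i t) s)
      (Rsum (fun i => f i t) s - Rsum (fun i => f i t) s0)) as H3.
    replace (_ + _) with (S t - Rsum (fun i => f i t) s0) in H3 by ring.
    lra. }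
  pose proof (continuous_Rsum f s0 x Hc) as Hcs.
  apply (proj1 (filterlim_locally _ _)) with (eps := mkposreal _ He) in Hcs.
  generalize (filter_and _ _ HU Hcs). apply filter_imp.
  intros t [[Ht1 Ht2] Ht3].
  destruct (locally_singleton _ _ HU) as [Hx1 Hx2].
  specialize (Htail t Ht1 Ht2) as E1. specialize (Htail x Hx1 Hx2) as E2.
  change (Rabs (Rsum (fun i => f i t) s0 - Rsum (fun i => f i x) s0) < eps / 4)
    in Ht3.
  change (Rabs (S t - S x) < eps).
  apply Rabs_le_between in E1. apply Rabs_le_between in E2.
  apply Rabs_def2 in Ht3. apply Rabs_def1; lra.
Qed.

Lemma sum_le_mono {I : Type} (f g : I -> R) B :
  (forall i, f i <= g i) -> sum_le g B -> sum_le f B.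
Proof.
  intros H HB s Hs. eapply Rle_trans; [now apply Rsum_le | now apply HB].
Qed.

Lemma sum_le_plus {I : Type} (f g : I -> R) B B' :
  sum_le f B -> sum_le g B' -> sum_le (fun i => f i + g i) (B + B').
Proof.
  intros H H' s Hs. rewrite Rsum_plus.
  specialize (H s Hs). specialize (H' s Hs). lra.
Qed.

Lemma sum_le_scal {I : Type} c (f : I -> R) B :
  0 <= c -> sum_le f B -> sum_le (fun i => c * f i) (c * B).
Proof.
  intros Hc H s Hs. rewrite Rsum_scal. apply Rmult_le_compat_l; auto.
Qed.

Lemma sum_le_injective {I J : Type} (f : J -> R) (phi : I -> J) B :
  FinFun.Injective phi -> sum_le f B -> sum_le (fun i => f (phi i)) B.
Proof.
  intros Hphi HB s Hs.
  replace (Rsum _ s) with (Rsum f (map phi s)).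
  - apply HB. now apply FinFun.Injective_map_NoDup.
  - clear. induction s; simpl; [easy | now rewrite IHs].
Qed.

(** A finite set of pairs lies in the product of its two projections, and over that product the sum
    factors. *)
Lemma sum_le_prod {I J : Type} (u : I -> R) (v : J -> R) U V :
  (forall i, 0 <= u i) -> (forall j, 0 <= v j) ->
  sum_le u U -> sum_le v V -> sum_le (fun p => u (fst p) * v (snd p)) (U * V).
Proof.
  intros Hu Hv HU HV s Hs.
  destruct (NoDup_same_elements (map fst s)) as [s1 [Hs1 Hin1]].
  destruct (NoDup_same_elements (map snd s)) as [s2 [Hs2 Hin2]].
  apply Rle_trans with (Rsum (fun p => u (fst p) * v (snd p)) (list_prod s1 s2)).
  - apply Rsum_incl; [|easy|].
    + intros p. now apply Rmult_le_pos.
    + intros [x y] Hp. apply in_prod.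
      * apply Hin1. now apply (in_map fst) in Hp.
      * apply Hin2. now apply (in_map snd) in Hp.
  - replace (Rsum _ _) with (Rsum u s1 * Rsum v s2).
    + apply Rmult_le_compat; auto using Rsum_nonneg.
    + clear. induction s1 as [|a s1 IH]; simpl; [ring|].
      rewrite Rsum_app, <- IH.
      replace (Rsum _ (map _ s2)) with (u a * Rsum v s2); [ring|].
      clear. induction s2; simpl; [ring | rewrite <- IHs2; ring].
Qed.

(** * F as an unordered sum *)

(** Properness makes limits along this filter unique, which is what allows [iota] to return the
    sum. *)
#[local] Instance finite_subsets_ProperFilter (I : Type) :
  ProperFilter (finite_subsets I).
Proof.
  split.
  - intros P [s0 H]. destruct (NoDup_same_elements s0) as [s [Hs Hin]].
    exists s. apply H; [easy|]. intros x Hx. now apply Hin.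
  - split.
    + now exists nil.
    + intros P Q [s0 H0] [s1 H1]. exists (s0 ++ s1). intros s Hs Hi.
      apply incl_app_inv in Hi. split; [apply H0 | apply H1]; tauto.
    + intros P Q HPQ [s0 H0]. exists s0. auto.
Qed.

Lemma is_Csum_of_Rsum {I : Type} (f : I -> C) x y :
  is_Rsum (fun i => fst (f i)) x -> is_Rsum (fun i => snd (f i)) y ->
  is_Csum f (x, y).
Proof.
  intros Hx Hy. apply filterlim_locally. intros eps.
  destruct (Hx eps (cond_pos eps)) as [s0 H0].
  destruct (Hy eps (cond_pos eps)) as [s1 H1].
  exists (s0 ++ s1). intros s Hs Hi. apply incl_app_inv in Hi.
  specialize (H0 s Hs (proj1 Hi)). specialize (H1 s Hs (proj2 Hi)).
  assert (E : Csum_list f s =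
    (Rsum (fun i => fst (f i)) s, Rsum (fun i => snd (f i)) s)).
  { clear. induction s; simpl; [easy | now rewrite IHs]. }
  rewrite E. split; [exact H0 | exact H1].
Qed.

Lemma Csum_unique {I : Type} (f : I -> C) l : is_Csum f l -> Csum f = l.
Proof.
  intros H.
  exact (iota_filterlim_locally (V := C_R_CompleteNormedModule)
           (F := finite_subsets I) (Csum_list f) l H).
Qed.

(** Convergence is established for the normalised family [K f]; multiplication by [/ K] carries it
    back to [f], where the total operator [Csum] can be evaluated. *)
Lemma Csum_scal {I : Type} (f : I -> C) (K : C) x y :
  K <> RtoC 0 ->
  is_Rsum (fun i => fst (K * f i)%C) x -> is_Rsum (fun i => snd (K * f i)%C) y ->
  (K * Csum f = (x, y))%C.
Proof.
  intros HK Hx Hy.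
  rewrite (Csum_unique f (/ K * (x, y))%C).
  - field; exact HK.
  - replace (/ K * (x, y))%C with
      (fst (/ K)%C * x + (- snd (/ K)%C) * y, fst (/ K)%C * y + snd (/ K)%C * x).
    2:{ apply injective_projections; simpl; ring. }
    assert (E : forall i, f i = (/ K * (K * f i))%C).
    { intros i. field; exact HK. }
    apply is_Csum_of_Rsum.
    + eapply is_Rsum_ext; [|apply is_Rsum_plus; apply is_Rsum_scal; eassumption].
      intros i. cbv beta. set (u := (K * f i)%C).
      replace (f i) with (/ K * u)%C by (symmetry; apply E).
      simpl; ring.
    + eapply is_Rsum_ext; [|apply is_Rsum_plus; apply is_Rsum_scal; eassumption].
      intros i. cbv beta. set (u := (K * f i)%C).
      replace (f i) with (/ K * u)%C by (symmetry; apply E).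
      simpl; ring.
Qed.

(* [- lin (c + d) d (theta / 2)] is [e^(-i theta/2) (c (z_theta + 1) + d)]. *)
Definition lin (a d t : R) : C := (- (a * cos t), d * sin t).

Definition term (m : nat) (p : Z * Z) (theta : R) : C :=
  if E_index p then
    (/ 2 * chi (snd p) *
     / (lin (IZR (fst p + snd p)) (IZR (snd p)) (theta / 2) ^ m))%C
  else RtoC 0.

Lemma E_index_spec c d : E_index (c, d) = true ->
  Z.even c = true /\ Z.odd d = true /\ Z.gcd c d = 1%Z.
Proof.
  unfold E_index; simpl. rewrite !Bool.andb_true_iff, Z.eqb_eq. tauto.
Qed.

Lemma Z_odd_neq_0 d : Z.odd d = true -> IZR d <> 0.
Proof. intros H H0. apply eq_IZR in H0. now subst. Qed.

Lemma half_angle theta :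
  cos theta = 2 * cos (theta / 2) ^ 2 - 1 /\
  sin theta = 2 * sin (theta / 2) * cos (theta / 2).
Proof.
  replace theta with (2 * (theta / 2)) at 1 3 by field.
  rewrite sin_2a, cos_2a_cos. split; ring.
Qed.

Lemma sin_half_pos theta : 0 < theta < PI -> 0 < sin (theta / 2).
Proof. intros H. apply sin_gt_0; lra. Qed.

Lemma z_neq_0 theta : 0 < theta < PI -> z_ theta <> RtoC 0.
Proof.
  intros H H0. apply (f_equal snd) in H0. unfold z_, expi in H0. simpl in H0.
  pose proof (sin_gt_0 theta). lra.
Qed.

Lemma expi_neq_0 t : expi t <> RtoC 0.
Proof.
  intros H. unfold expi, RtoC in H. injection H as H1 H2.
  pose proof (sin2_cos2 t) as H3. rewrite H1, H2 in H3. unfold Rsqr in H3. lra.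
Qed.

(* [z_theta + 1 = cos (theta/2) e^(i theta/2)] *)
Lemma expi_mult_shifted_z c d theta :
  (expi (- theta / 2) * (IZR c * (z_ theta + 1) + IZR d))%C =
  (- lin (IZR (c + d)) (IZR d) (theta / 2))%C.
Proof.
  destruct (half_angle theta) as [E1 E2].
  pose proof (sin2_cos2 (theta / 2)) as E3. unfold Rsqr in E3.
  unfold expi, z_, lin, expi. rewrite plus_IZR.
  replace (- theta / 2) with (- (theta / 2)) by field.
  rewrite cos_neg, sin_neg.
  apply injective_projections; simpl; rewrite E1, E2;
    set (s := sin (theta / 2)) in *; set (x := cos (theta / 2)) in *.
  - transitivity (IZR c * (x * (x * x + s * s)) + IZR d * x); [field|].
    replace (x * x + s * s) with 1 by lra. ring.
  - field.
Qed.

Lemma lin_neq_0 a d t : d <> 0 -> sin t <> 0 -> lin a d t <> RtoC 0.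
Proof.
  intros Hd Ht H. apply (f_equal snd) in H. simpl in H.
  apply Rmult_integral in H. tauto.
Qed.

(* [G_m |_m gamma_1] is [z |-> -E (z + 1)], because
   [gamma_0 gamma_1 = - (1 1; 0 1)]. *)
Lemma F_eq_sum m theta x y : 0 < theta < PI ->
  is_Rsum (fun p => fst (term m p theta)) x ->
  is_Rsum (fun p => snd (term m p theta)) y ->
  F m theta = (x, y).
Proof.
  intros Ht Hx Hy.
  pose proof (z_neq_0 theta Ht) as Hz.
  pose proof (expi_neq_0 (- theta / 2)) as He.
  pose proof (sin_half_pos theta Ht) as Hs.
  unfold F, slash, G, slash, E. cbn -[Cpow Csum E_index chi].
  set (e := expi (- theta / 2)) in *. set (z := z_ theta) in *.
  assert (H1 : (1 * z + 0)%C = z) by ring.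
  rewrite H1.
  set (w := ((0 * z + -1) / z)%C).
  assert (Hw : w = (- / z)%C) by (unfold w; field; exact Hz).
  assert (Hw0 : w <> RtoC 0).
  { intros H. apply (f_equal (fun u => - (z * u))%C) in H.
    rewrite Hw in H. replace (- (z * - / z))%C with (RtoC 1) in H
      by (field; exact Hz).
    apply (f_equal fst) in H. simpl in H. lra. }
  assert (H2 : (1 * w + 0)%C = w) by ring.
  rewrite H2.
  assert (H3 : ((1 * w + -1) / w = z + 1)%C).
  { rewrite Hw. field. exact Hz. }
  rewrite H3.
  assert (H2' : (2 : C) <> RtoC 0).
  { intros H. apply (f_equal fst) in H. simpl in H. lra. }
  set (f := fun p : Z * Z => if E_index p
     then (chi (snd p) * / (IZR (fst p) * (z + 1) + IZR (snd p)) ^ m)%C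
     else RtoC 0).
  (* All factors in front of the series: the normalisation of [F], the automorphy factors of
     [gamma1] and [gamma0], and the [1/2] of [E]. *)
  set (K := (/ e ^ m * (/ z ^ m * (/ w ^ m * / 2)))%C).
  assert (HK : forall p, term m p theta = (K * f p)%C).
  { intros [c d]. unfold term, f. destruct (E_index (c, d)) eqn:Hp;
      cbn [fst snd]; [|ring].
    destruct (E_index_spec _ _ Hp) as [_ [Hd _]].
    pose proof (expi_mult_shifted_z c d theta) as HX. fold e z in HX.
    set (X := (IZR c * (z + 1) + IZR d)%C) in *.
    assert (Hl := lin_neq_0 (IZR (c + d)) _ (theta / 2) (Z_odd_neq_0 d Hd)
                    (Rgt_not_eq _ _ Hs)).
    set (u := lin _ _ _) in *.
    (* Since [z w = -1] and [e X = -u], the two signs cancel before the power is taken. *)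
    assert (Hu : u = (e * (z * (w * X)))%C).
    { transitivity (- (e * X))%C; [rewrite HX; ring|].
      rewrite Hw. field. exact Hz. }
    assert (HX0 : X <> RtoC 0).
    { intros H. apply Hl. rewrite Hu, H. ring. }
    rewrite Hu, !Cpow_mult_l. unfold K.
    field. repeat split; try exact H2'; now apply Cpow_nz. }
  rewrite <- (Csum_scal f K x y).
  - unfold K. rewrite !Cmult_assoc. reflexivity.
  - assert (Hi : forall u : C, u <> RtoC 0 -> (/ u)%C <> RtoC 0).
    { intros u Hu H. apply (f_equal (fun v => u * v)%C) in H.
      rewrite Cinv_r in H by easy. apply (f_equal fst) in H. simpl in H. lra. }
    unfold K. repeat apply Cmult_neq_0; apply Hi; try now apply Cpow_nz.
    exact H2'.
  - eapply is_Rsum_ext; [|exact Hx]. intros p. cbv beta. now rewrite HK.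
  - eapply is_Rsum_ext; [|exact Hy]. intros p. cbv beta. now rewrite HK.
Qed.

(** * The majorant *)

Lemma Rsum_le_support {I : Type} (f : I -> R) (s L : list I) :
  (forall i, 0 <= f i) -> NoDup s ->
  (forall i, In i s -> f i <> 0 -> In i L) -> Rsum f s <= Rsum f L.
Proof.
  intros Hf Hs HL.
  assert (exists s', NoDup s' /\ incl s' s /\ incl s' L /\ Rsum f s' = Rsum f s)
    as [s' [H1 [_ [H2 <-]]]].
  { clear -Hs HL. induction Hs as [|a s Ha Hs IH].
    - exists nil. repeat split; try constructor; easy.
    - destruct IH as [s' [H1 [H2 [H3 H4]]]].
      { intros i Hi. apply HL. now right. }
      destruct (Req_dec (f a) 0) as [E|E].
      + exists s'. repeat split; try easy.
        * now apply incl_tl.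
        * simpl. lra.
      + exists (a :: s'). repeat split.
        * constructor; auto.
        * apply incl_cons; [now left | now apply incl_tl].
        * apply incl_cons; [apply HL; [now left | easy] | easy].
        * simpl. now rewrite H4. }
  now apply Rsum_incl.
Qed.

Definition ind_abs (k a : Z) : R := if (Z.abs a =? k)%Z then 1 else 0.

Definition inv_sq_from (k a : Z) : R :=
  if (Z.odd a && (k <=? Z.abs a)%Z)%bool then / IZR a ^ 2 else 0.

Lemma ind_abs_nonneg k a : 0 <= ind_abs k a.
Proof. unfold ind_abs. destruct (_ =? _)%Z; lra. Qed.

Lemma inv_sq_from_nonneg k a : 0 <= inv_sq_from k a.
Proof.
  unfold inv_sq_from. destruct (Z.odd a) eqn:H; simpl; [|lra].
  destruct (_ <=? _)%Z; [|lra].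
  left. apply Rinv_0_lt_compat. apply Z_odd_neq_0 in H. nra.
Qed.

Lemma sum_le_ind_abs k : sum_le (ind_abs k) 2.
Proof.
  intros s Hs. apply Rle_trans with (Rsum (ind_abs k) (k :: (- k)%Z :: nil)).
  - apply Rsum_le_support; [apply ind_abs_nonneg | easy |].
    intros i _. unfold ind_abs. destruct (Z.eqb_spec (Z.abs i) k) as [E|E].
    + intros _. simpl. lia.
    + easy.
  - simpl. unfold ind_abs. do 2 destruct (_ =? _)%Z; lra.
Qed.

Fixpoint odds (n : nat) : list Z :=
  match n with
  | O => nil
  | S n => (2 * Z.of_nat n + 1)%Z :: (- (2 * Z.of_nat n + 1))%Z :: odds n
  end.

Lemma In_odds n a : Z.odd a = true -> (Z.abs a < 2 * Z.of_nat n)%Z -> In a (odds n).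
Proof.
  intros Ha. apply Z.odd_spec in Ha. destruct Ha as [b ->].
  induction n as [|n IH]; intros H; [lia|].
  destruct (Z_lt_ge_dec (Z.abs (2 * b + 1)) (2 * Z.of_nat n)) as [H1|H1].
  - right; right; auto.
  - cbn [odds]. destruct (Z_le_gt_dec 0 b); [left | right; left]; lia.
Qed.

Lemma odds_bound (s : list Z) :
  exists n, (3 <= n)%nat /\ forall a, In a s -> Z.odd a = true -> In a (odds n).
Proof.
  assert (exists n, (3 <= n)%nat /\
    forall a, In a s -> (Z.abs a < 2 * Z.of_nat n)%Z) as [n [H0 H]].
  { induction s as [|a s [n [H0 H]]].
    - exists 3%nat. easy.
    - exists (n + Z.abs_nat a)%nat. split; [lia|].
      intros b [<-|Hb]; [lia | specialize (H b Hb); lia]. }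
  exists n. split; [easy|]. intros a Ha1 Ha2. apply In_odds; auto.
Qed.

(* [2 / (2 n + 1)^2 <= 1 / (2 n) - 1 / (2 (n + 1))] makes the sum telescope. *)
Lemma sum_le_inv_sq_from k n0 B :
  (1 <= n0 <= 3)%nat ->
  Rsum (inv_sq_from k) (odds n0) <= B - / (2 * INR n0) ->
  sum_le (inv_sq_from k) B.
Proof.
  intros Hn0 H0 s Hs. destruct (odds_bound s) as [n [Hn Hin]].
  apply Rle_trans with (Rsum (inv_sq_from k) (odds n)).
  - apply Rsum_le_support; [apply inv_sq_from_nonneg | easy |].
    intros i Hi Hf. apply Hin; [easy|]. unfold inv_sq_from in Hf.
    destruct (Z.odd i); [easy | now simpl in Hf].
  - assert (H : forall n, (n0 <= n)%nat ->
      Rsum (inv_sq_from k) (odds n) <= B - / (2 * INR n)).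
    { clear -Hn0 H0. intros n Hn. induction Hn as [|n Hn IH]; [easy|].
      assert (Hx : forall a, inv_sq_from k a <= / IZR a ^ 2).
      { intros a. unfold inv_sq_from.
        destruct (_ && _)%bool; [lra|].
        destruct (Req_dec (IZR a) 0) as [E|E].
        - rewrite E. replace (0 ^ 2) with 0 by ring. rewrite Rinv_0. lra.
        - left. apply Rinv_0_lt_compat. nra. }
      cbn [odds Rsum fold_right]. fold (Rsum (inv_sq_from k) (odds n)).
      pose proof (Hx (2 * Z.of_nat n + 1)%Z) as H1.
      pose proof (Hx (- (2 * Z.of_nat n + 1))%Z) as H2.
      rewrite opp_IZR in H2.
      rewrite plus_IZR, mult_IZR, <- INR_IZR_INZ in H1, H2.
      assert (Hr : 1 <= INR n) by (apply (le_INR 1); lia).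
      rewrite S_INR. set (x := INR n) in *.
      assert (H3 : (- (2 * x + 1)) ^ 2 = (2 * x + 1) ^ 2) by ring.
      rewrite H3 in H2.
      assert (H4 : / (2 * x + 1) ^ 2 <= (/ (2 * x) - / (2 * (x + 1))) / 2).
      { replace ((/ (2 * x) - / (2 * (x + 1))) / 2) with (/ (4 * x * (x + 1)))
          by (field; lra).
        apply Rinv_le_contravar; nra. }
      lra. }
    assert (0 < INR n) by (apply lt_0_INR; lia).
    assert (0 < / (2 * INR n)) by (apply Rinv_0_lt_compat; lra).
    specialize (H n). assert (Hn' : (n0 <= n)%nat) by lia.
    specialize (H Hn'). lra.
Qed.

(** The pair [1, -1] contributes 2 and the telescoped tail 1/2; the exact total is [PI^2 / 4], about
    2.467. *)
Lemma sum_le_inv_sq_1 : sum_le (inv_sq_from 1) (5 / 2).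
Proof.
  apply sum_le_inv_sq_from with (n0 := 1%nat); [lia|].
  unfold inv_sq_from; simpl. lra.
Qed.

(** The entries up to 3 in absolute value contribute nothing, so only the tail bound [1 / (2 * 2)]
    remains. *)
Lemma sum_le_inv_sq_5 : sum_le (inv_sq_from 5) (1 / 4).
Proof.
  apply sum_le_inv_sq_from with (n0 := 2%nat); [lia|].
  unfold inv_sq_from; simpl. lra.
Qed.

(* The pairs with [{|a|, |d|} = {1, 3}], where [a = c + d], dominate and get the
   weights [X] and [Y]. All other pairs of coprime odd numbers, [(1, 1)] apart,
   have a component of absolute value at least 5; for them
   [(a^2 cos^2 + d^2 sin^2)^2 >= 4 cos^2 sin^2 a^2 d^2] yields a summable bound. *)
Definition majorant (X Y : R) (p : Z * Z) : R :=
  let a := (fst p + snd p)%Z in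
  let d := snd p in
  / 2 * (X * (ind_abs 1 a * ind_abs 3 d) + Y * (ind_abs 3 a * ind_abs 1 d) +
         / 40 * (inv_sq_from 1 a * inv_sq_from 5 d +
                  inv_sq_from 5 a * inv_sq_from 1 d)).

Lemma majorant_nonneg X Y p : 0 <= X -> 0 <= Y -> 0 <= majorant X Y p.
Proof.
  intros HX HY. unfold majorant.
  apply Rmult_le_pos; [lra|].
  repeat apply Rplus_le_le_0_compat; (apply Rmult_le_pos; [lra|]);
    try apply Rplus_le_le_0_compat;
    apply Rmult_le_pos; auto using ind_abs_nonneg, inv_sq_from_nonneg.
Qed.

(** The injective substitution [a = c + d] turns the majorant into a combination of products of
    one-variable families. The constant is [1/2 * 1/40 * 2 * (5/2 * 1/4)]. *)
Lemma sum_le_majorant X Y : 0 <= X -> 0 <= Y ->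
  sum_le (majorant X Y) (2 * (X + Y) + 0.015625).
Proof.
  intros HX HY.
  pose (f := fun p : Z * Z => / 2 * (
      (X * (ind_abs 1 (fst p) * ind_abs 3 (snd p)) +
       Y * (ind_abs 3 (fst p) * ind_abs 1 (snd p))) +
      / 40 * (inv_sq_from 1 (fst p) * inv_sq_from 5 (snd p) +
               inv_sq_from 5 (fst p) * inv_sq_from 1 (snd p)))).
  apply (sum_le_injective f (fun p => ((fst p + snd p)%Z, snd p))).
  - intros [c d] [c' d']; simpl. intros H; injection H; intros; f_equal; lia.
  - replace (2 * (X + Y) + 0.015625) with
      (/ 2 * ((X * (2 * 2) + Y * (2 * 2)) + 
        / 40 * (5 / 2 * (1 / 4) + 1 / 4 * (5 / 2)))) by lra.
    apply sum_le_scal; [lra|].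
    repeat apply sum_le_plus; apply sum_le_scal; try lra;
      [| |apply sum_le_plus]; apply sum_le_prod;
      auto using ind_abs_nonneg, inv_sq_from_nonneg, sum_le_ind_abs,
        sum_le_inv_sq_1, sum_le_inv_sq_5.
Qed.

(** The exponent is split as [1 + 2 * 15 + 2 n]: [r0] bounds [N], [q0] bounds [N^2], and the last
    part supplies the geometric factor common to all bounds. *)
Lemma inv_pow_le (N q0 r0 : R) (n : nat) : 0 < N -> 0 < r0 -> r0 * r0 <= q0 ->
  1.19 <= q0 -> q0 <= N ^ 2 ->
  / N ^ (31 + 2 * n) <= / (r0 * q0 ^ 15) * (/ 1.19) ^ n.
Proof.
  intros HN Hr0 Hr Hq HQ.
  assert (HrN : r0 <= N) by nra.
  rewrite pow_inv, <- Rinv_mult.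
  replace (N ^ (31 + 2 * n)) with (N * (N ^ 2) ^ 15 * (N ^ 2) ^ n).
  2:{ replace (31 + 2 * n)%nat with (1 + 2 * 15 + 2 * n)%nat by lia.
      rewrite !pow_add, !pow_mult, pow_1. ring. }
  apply Rinv_le_contravar.
  - repeat apply Rmult_lt_0_compat; try lra; apply pow_lt; lra.
  - apply Rmult_le_compat.
    + apply Rmult_le_pos; [lra | apply pow_le; lra].
    + apply pow_le; lra.
    + apply Rmult_le_compat; try lra; [apply pow_le; lra | apply pow_incr; lra].
    + apply pow_incr; lra.
Qed.

(** Here [q] will be [a^2 d^2]. In [N * (N^2)^13 * N^4] the factor [N^4] pays for the summable
    weight [/ q]; the rest is at least [1.25 * 1.57^13 > 434], and [434 * 0.0929 > 40]. *)
Lemma inv_pow_le_weight (N q : R) (n : nat) : 0 < N -> 0 < q ->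
  1.57 <= N ^ 2 -> 0.0929 * q <= N ^ 4 ->
  / N ^ (31 + 2 * n) <= / 40 * / q * (/ 1.19) ^ n.
Proof.
  intros HN Hq0 HQ Hq.
  assert (HrN : 1.25 <= N) by nra.
  rewrite pow_inv, <- !Rinv_mult.
  replace (N ^ (31 + 2 * n)) with (N * (N ^ 2) ^ 13 * N ^ 4 * (N ^ 2) ^ n).
  2:{ replace (31 + 2 * n)%nat with (1 + 2 * 13 + 4 + 2 * n)%nat by lia.
      rewrite !pow_add, !pow_mult, pow_1. ring. }
  assert (H13 : 1.57 ^ 13 <= (N ^ 2) ^ 13) by (apply pow_incr; lra).
  assert (H1 : 434 <= N * (N ^ 2) ^ 13).
  { apply Rle_trans with (1.25 * 1.57 ^ 13); [lra|].
    apply Rmult_le_compat; lra. }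
  apply Rinv_le_contravar.
  - repeat apply Rmult_lt_0_compat; try lra; apply pow_lt; lra.
  - apply Rmult_le_compat; try (apply pow_incr; lra); try (apply pow_le; lra);
      [lra|].
    apply Rle_trans with (434 * (0.0929 * q)); [lra|].
    apply Rmult_le_compat; lra.
Qed.

Lemma inv_pow_le_majorant (c d : Z) (Cs Sn N X Y : R) (n : nat) :
  E_index (c, d) = true ->
  ~ (Z.abs (c + d) = 1 /\ Z.abs d = 1)%Z ->
  0.0238 <= Cs -> 0.0238 <= Sn -> Cs + Sn = 1 ->
  0 < N -> N ^ 2 = IZR (c + d) ^ 2 * Cs + IZR d ^ 2 * Sn ->
  0.068 <= X \/ 1 / 2 <= Sn /\ 0.0001 <= X ->
  0.068 <= Y \/ 1 / 2 <= Cs /\ 0.0001 <= Y ->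
  / 2 * / N ^ (31 + 2 * n) <= majorant X Y (c, d) * (/ 1.19) ^ n.
Proof.
  intros Hp Hnm HC HS HCS HN HQ HX HY.
  destruct (E_index_spec _ _ Hp) as [Hc [Hd Hg]].
  set (a := (c + d)%Z) in *.
  assert (Ha : Z.odd a = true).
  { unfold a. rewrite Z.odd_add, Hd, <- Z.negb_even, Hc. easy. }
  assert (HX0 : 0 <= X) by lra. assert (HY0 : 0 <= Y) by lra.
  assert (Hrho : 0 < (/ 1.19) ^ n) by (apply pow_lt; lra).
  pose proof (inv_sq_from_nonneg 1 a). pose proof (inv_sq_from_nonneg 1 d).
  pose proof (inv_sq_from_nonneg 5 a). pose proof (inv_sq_from_nonneg 5 d).
  pose proof (ind_abs_nonneg 1 a). pose proof (ind_abs_nonneg 1 d).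
  pose proof (ind_abs_nonneg 3 a). pose proof (ind_abs_nonneg 3 d).
  assert (H13 : 0 <= X * (ind_abs 1 a * ind_abs 3 d))
    by (apply Rmult_le_pos; [easy | now apply Rmult_le_pos]).
  assert (H31 : 0 <= Y * (ind_abs 3 a * ind_abs 1 d))
    by (apply Rmult_le_pos; [easy | now apply Rmult_le_pos]).
  assert (H15 : 0 <= inv_sq_from 1 a * inv_sq_from 5 d)
    by now apply Rmult_le_pos.
  assert (H51 : 0 <= inv_sq_from 5 a * inv_sq_from 1 d)
    by now apply Rmult_le_pos.
  assert (Hsq : forall k z, (Z.abs z = k)%Z -> IZR z ^ 2 = IZR k ^ 2).
  { intros k z <-. rewrite abs_IZR. symmetry. apply pow2_abs. }
  assert (Hge : forall z k, (0 <= k <= Z.abs z)%Z -> IZR k ^ 2 <= IZR z ^ 2).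
  { intros z k [Hk0 Hk]. rewrite (Hsq (Z.abs z) z) by easy.
    apply pow_incr. split; now apply IZR_le. }
  assert (Ha1 : (1 <= Z.abs a)%Z).
  { destruct (Z.eq_dec a 0) as [E|E]; [rewrite E in Ha; easy | lia]. }
  assert (Hd1 : (1 <= Z.abs d)%Z).
  { destruct (Z.eq_dec d 0) as [E|E]; [rewrite E in Hd; easy | lia]. }
  (* Coprimality enters here: with [|a| = |d| = 3] both [d] and [c = a - d] would be divisible by
     3. *)
  assert (Hcase : (Z.abs a = 1 /\ Z.abs d = 3)%Z \/ (Z.abs a = 3 /\ Z.abs d = 1)%Z
    \/ (5 <= Z.abs d)%Z \/ (5 <= Z.abs a)%Z).
  { assert (Ho : forall z, Z.odd z = true -> (1 <= Z.abs z)%Z ->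
      (Z.abs z = 1 \/ Z.abs z = 3 \/ 5 <= Z.abs z)%Z).
    { intros z Hz Hz1. apply Z.odd_spec in Hz. destruct Hz as [b ->]. lia. }
    destruct (Ho a Ha Ha1) as [|[|]]; destruct (Ho d Hd Hd1) as [|[|]]; try tauto.
    exfalso.
    assert (E : (3 | Z.gcd c d)%Z).
    { apply Z.gcd_greatest.
      - assert (c = 0 \/ c = 6 \/ c = -6)%Z as [-> | [-> | ->]] by lia;
          [exists 0%Z | exists 2%Z | exists (-2)%Z]; easy.
      - assert (d = 3 \/ d = -3)%Z as [-> | ->] by lia;
          [exists 1%Z | exists (-1)%Z]; easy. }
    rewrite Hg in E. apply Z.divide_1_r in E. lia. }
  unfold majorant. cbn [fst snd]. fold a.
  rewrite Rmult_assoc. apply Rmult_le_compat_l; [lra|].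
  assert (Hmaj : forall v, / N ^ (31 + 2 * n) <= v * (/ 1.19) ^ n ->
    v <= X * (ind_abs 1 a * ind_abs 3 d) + Y * (ind_abs 3 a * ind_abs 1 d) +
      / 40 * (inv_sq_from 1 a * inv_sq_from 5 d +
              inv_sq_from 5 a * inv_sq_from 1 d) ->
    / N ^ (31 + 2 * n) <=
      (X * (ind_abs 1 a * ind_abs 3 d) + Y * (ind_abs 3 a * ind_abs 1 d) +
      / 40 * (inv_sq_from 1 a * inv_sq_from 5 d +
              inv_sq_from 5 a * inv_sq_from 1 d)) * (/ 1.19) ^ n).
  { intros v Hv1 Hv2. eapply Rle_trans; [exact Hv1|].
    apply Rmult_le_compat_r; lra. }
  (* [T] is [Sn] for the pair (1, 3) and [Cs] for (3, 1). In general [N^2 >= 1 + 8 * 0.0238 > 1.19],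
     and [/ (1.09 * 1.19^15)] is about 0.0675. If [T >= 1/2], then [N^2 >= 5] and the term is
     negligible. *)
  assert (Hexc : forall W T, 0.068 <= W \/ 1 / 2 <= T /\ 0.0001 <= W ->
    0.0238 <= T -> N ^ 2 = 1 + 8 * T -> / N ^ (31 + 2 * n) <= W * (/ 1.19) ^ n).
  { intros W T HW HT HNT. destruct HW as [HW|[HT2 HW]].
    - eapply Rle_trans; [apply (inv_pow_le N 1.19 1.09); lra|].
      apply Rmult_le_compat_r; lra.
    - eapply Rle_trans; [apply (inv_pow_le N 5 2); lra|].
      apply Rmult_le_compat_r; lra. }
  assert (Hw : forall z k, Z.odd z = true -> (k <= Z.abs z)%Z ->
    inv_sq_from k z = / IZR z ^ 2).
  { intros z k Hz Hk. unfold inv_sq_from. rewrite Hz.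
    apply Z.leb_le in Hk. now rewrite Hk. }
  (* With sum 1 and both factors at least 0.0238, the product is at least [0.0238 * 0.9762]; four
     times 0.02323 exceeds 0.0929. *)
  assert (HCS2 : 0.02323 <= Cs * Sn) by nra.
  pose proof (Hge a 1%Z (conj Z.le_0_1 Ha1)) as Qa.
  pose proof (Hge d 1%Z (conj Z.le_0_1 Hd1)) as Qd.
  assert (Hq4 : 0.0929 * (IZR a ^ 2 * IZR d ^ 2) <= N ^ 4).
  { replace (N ^ 4) with ((N ^ 2) ^ 2) by ring. rewrite HQ.
    set (x := IZR a ^ 2) in *. set (y := IZR d ^ 2) in *.
    apply Rle_trans with (4 * (Cs * Sn) * (x * y)).
    - apply Rmult_le_compat_r; [nra | lra].
    - pose proof (pow2_ge_0 (x * Cs - y * Sn)). nra. }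
  assert (Hweight : 1.57 <= N ^ 2 ->
    / N ^ (31 + 2 * n) <= / 40 * (/ IZR a ^ 2 * / IZR d ^ 2) * (/ 1.19) ^ n).
  { intros HN2. rewrite <- Rinv_mult. apply inv_pow_le_weight; try easy. nra. }
  destruct Hcase as [[E1 E2] | [[E1 E2] | [E2 | E1]]].
  - apply (Hmaj X).
    + apply (Hexc X Sn); [easy | easy |].
      rewrite HQ, (Hsq _ _ E1), (Hsq _ _ E2). lra.
    + unfold ind_abs in *. rewrite E1, E2 in *. simpl in *. lra.
  - apply (Hmaj Y).
    + apply (Hexc Y Cs); [easy | easy |].
      rewrite HQ, (Hsq _ _ E1), (Hsq _ _ E2). lra.
    + unfold ind_abs in *. rewrite E1, E2 in *. simpl in *. lra.
  - apply (Hmaj (/ 40 * (/ IZR a ^ 2 * / IZR d ^ 2))).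
    (* [N^2 >= Cs + 25 Sn >= 1 + 24 * 0.0238 > 1.57]. *)
    + apply Hweight. pose proof (Hge d 5%Z ltac:(lia)) as Q5.
      apply (Rmult_le_compat_r Sn) in Q5; [|lra].
      apply (Rmult_le_compat_r Cs) in Qa; [|lra]. rewrite HQ. lra.
    + rewrite (Hw a 1%Z), (Hw d 5%Z) by easy. lra.
  - apply (Hmaj (/ 40 * (/ IZR a ^ 2 * / IZR d ^ 2))).
    + apply Hweight. pose proof (Hge a 5%Z ltac:(lia)) as Q5.
      apply (Rmult_le_compat_r Cs) in Q5; [|lra].
      apply (Rmult_le_compat_r Sn) in Qd; [|lra]. rewrite HQ. lra.
    + rewrite (Hw d 1%Z), (Hw a 5%Z) by easy. lra.
Qed.

(** * Main term and remainder *)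

(** Otherwise [PI / 2] would lie in [(3/2, 1.55]], where the Taylor polynomial of degree 6, a lower
    bound of the cosine, is still positive. *)
Lemma PI_gt_3_1 : 3.1 < PI.
Proof.
  apply Rnot_le_lt. intros H.
  pose proof PI2_3_2 as H1.
  destruct (pre_cos_bound (PI / 2) 1) as [H2 _]; [lra | lra |].
  rewrite cos_PI2 in H2. unfold cos_approx, cos_term in H2. simpl in H2.
  assert (Hx : 3 / 2 < PI / 2 <= 1.55) by (split; lra).
  set (x := PI / 2) in *. clearbody x.
  assert (Hx2 : 2.25 <= x * x <= 2.4025) by (split; nra).
  set (y := x * x) in *.
  assert (0 < 1 - y / 2 + y * y / 24 - y * y * y / 720) by nra.
  unfold y in *. lra.
Qed.

Lemma sin_ge_cubic x : 0 <= x <= 4 -> x - x ^ 3 / 6 <= sin x.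
Proof.
  intros H. destruct (pre_sin_bound x 0) as [H1 _]; [easy | easy |].
  unfold sin_approx, sin_term in H1. simpl in H1. simpl. lra.
Qed.

Lemma cos_ge_quadratic x : -2 <= x <= 2 -> 1 - x ^ 2 / 2 <= cos x.
Proof.
  intros H. destruct (pre_cos_bound x 0) as [H1 _]; [easy | easy |].
  unfold cos_approx, cos_term in H1. simpl in H1. simpl. lra.
Qed.

(* An open neighbourhood of [range] on which the estimates still hold: the end
   points of an interval contained in [range] may be those of [range]. *)
Definition inner (theta : R) : Prop := 0.31 < theta < PI - 0.31.

Lemma inner_0_PI theta : inner theta -> 0 < theta < PI.
Proof. unfold inner. lra. Qed.

Lemma range_inner theta : range theta -> inner theta.
Proof. unfold range, inner. pose proof PI_gt_3_1. lra. Qed.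

(** 0.155 is half the margin 0.31 of [inner], and [0.1543^2 > 0.0238]. The numerical bounds on [lin]
    all derive from 0.0238. *)
Lemma sin_half_inner t : 0.155 <= t <= PI / 2 -> 0.0238 <= sin t ^ 2.
Proof.
  intros H. pose proof PI_gt_3_1.
  assert (H1 : 0.1543 <= sin 0.155).
  { eapply Rle_trans; [|apply sin_ge_cubic; lra]. lra. }
  assert (H2 : sin 0.155 <= sin t) by (apply sin_incr_1; lra).
  nra.
Qed.

Lemma inner_trig theta : inner theta ->
  0.0238 <= cos (theta / 2) ^ 2 /\ 0.0238 <= sin (theta / 2) ^ 2 /\
  cos (theta / 2) ^ 2 + sin (theta / 2) ^ 2 = 1.
Proof.
  unfold inner. intros H. repeat split.
  - rewrite <- sin_shift. apply sin_half_inner. lra.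
  - apply sin_half_inner. lra.
  - pose proof (sin2_cos2 (theta / 2)) as E. unfold Rsqr in E. lra.
Qed.

Lemma Cmod_lin_sqr a d t :
  Cmod (lin a d t) ^ 2 = a ^ 2 * cos t ^ 2 + d ^ 2 * sin t ^ 2.
Proof.
  unfold Cmod, lin. cbn [fst snd]. rewrite pow2_sqrt; [ring|].
  apply Rplus_le_le_0_compat; apply pow2_ge_0.
Qed.

Lemma chi_abs_le d : Rabs (chi d) <= 1.
Proof.
  unfold chi. destruct (_ =? 1)%Z; [|destruct (_ =? 3)%Z];
    unfold Rabs; destruct Rcase_abs; lra.
Qed.

Lemma lin_inner_neq_0 p theta : E_index p = true -> inner theta ->
  lin (IZR (fst p + snd p)) (IZR (snd p)) (theta / 2) <> RtoC 0.
Proof.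
  destruct p as [c d]. intros Hp Ht. destruct (E_index_spec _ _ Hp) as [_ [Hd _]].
  apply lin_neq_0; [now apply Z_odd_neq_0|].
  apply Rgt_not_eq, sin_half_pos, inner_0_PI, Ht.
Qed.

Definition is_main (p : Z * Z) : bool :=
  ((Z.abs (fst p + snd p) =? 1) && (Z.abs (snd p) =? 1))%Z%bool.

Lemma Cmod_half_chi d : Cmod (/ 2 * chi d)%C <= / 2.
Proof.
  replace (/ 2 * chi d)%C with (RtoC (/ 2 * chi d)).
  2:{ apply injective_projections; simpl; field. }
  rewrite Cmod_R, Rabs_mult, (Rabs_right (/ 2)) by lra.
  pose proof (chi_abs_le d). lra.
Qed.

Lemma term_Cmod_le m p theta : inner theta -> E_index p = true ->
  Cmod (term m p theta) <=
  / 2 * / Cmod (lin (IZR (fst p + snd p)) (IZR (snd p)) (theta / 2)) ^ m.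
Proof.
  intros Ht Hp. pose proof (lin_inner_neq_0 p theta Hp Ht) as Hl.
  unfold term. rewrite Hp, Cmod_mult.
  rewrite Cmod_inv by now apply Cpow_nz.
  rewrite Cmod_pow. apply Rmult_le_compat_r; [|apply Cmod_half_chi].
  left. apply Rinv_0_lt_compat, pow_lt. now apply Cmod_gt_0.
Qed.

(* A weight may be tiny on the half of the range where its terms are small;
   taking both weights large would break the final numerical comparison. *)
Definition majorant_weights (X Y theta : R) : Prop :=
  (0.068 <= X \/ 1 / 2 <= sin (theta / 2) ^ 2 /\ 0.0001 <= X) /\
  (0.068 <= Y \/ 1 / 2 <= cos (theta / 2) ^ 2 /\ 0.0001 <= Y).

Lemma inv_Cmod_lin_le_majorant n p theta X Y :
  inner theta -> E_index p = true -> is_main p = false ->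
  majorant_weights X Y theta ->
  / 2 * / Cmod (lin (IZR (fst p + snd p)) (IZR (snd p)) (theta / 2)) ^ (31 + 2 * n)
  <= majorant X Y p * (/ 1.19) ^ n.
Proof.
  intros Ht Hp Hm [HX HY]. destruct p as [c d]. cbn [fst snd].
  destruct (inner_trig theta Ht) as [H1 [H2 H3]].
  apply inv_pow_le_majorant with (Cs := cos (theta / 2) ^ 2)
    (Sn := sin (theta / 2) ^ 2); try easy.
  - unfold is_main in Hm. cbn [fst snd] in Hm.
    intros [E1 E2]. rewrite E1, E2 in Hm. easy.
  - apply Cmod_gt_0. now apply (lin_inner_neq_0 (c, d)).
  - apply Cmod_lin_sqr.
Qed.

Definition rest (m : nat) (p : Z * Z) (theta : R) : C :=
  if is_main p then RtoC 0 else term m p theta.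

Lemma rest_Cmod_le n p theta X Y : inner theta -> majorant_weights X Y theta ->
  Cmod (rest (31 + 2 * n) p theta) <= majorant X Y p * (/ 1.19) ^ n.
Proof.
  intros Ht HXY.
  assert (H0 : 0 <= majorant X Y p * (/ 1.19) ^ n).
  { apply Rmult_le_pos; [|apply pow_le; lra].
    destruct HXY. apply majorant_nonneg; lra. }
  unfold rest. destruct (is_main p) eqn:Hm; [now rewrite Cmod_0|].
  destruct (E_index p) eqn:Hp.
  - eapply Rle_trans; [now apply term_Cmod_le|].
    now apply inv_Cmod_lin_le_majorant.
  - unfold term. rewrite Hp, Cmod_0. easy.
Qed.

Definition main_indices : list (Z * Z) :=
  ((0, 1) :: (0, -1) :: (2, -1) :: (-2, 1) :: nil)%Z.

Lemma NoDup_main_indices : NoDup main_indices.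
Proof.
  unfold main_indices. repeat constructor; simpl; intuition congruence.
Qed.

Lemma In_main_indices p : is_main p = true -> In p main_indices.
Proof.
  destruct p as [c d]. unfold is_main. cbn [fst snd].
  rewrite Bool.andb_true_iff, !Z.eqb_eq. intros [H1 H2].
  assert (d = 1 \/ d = -1)%Z as [-> | ->] by lia.
  - assert (c = 0 \/ c = -2)%Z as [-> | ->] by lia; simpl; tauto.
  - assert (c = 0 \/ c = 2)%Z as [-> | ->] by lia; simpl; tauto.
Qed.

Lemma is_Rsum_term m theta (pr : C -> R) l : pr (RtoC 0) = 0 ->
  is_Rsum (fun p => pr (rest m p theta)) l ->
  is_Rsum (fun p => pr (term m p theta))
    (Rsum (fun p => pr (term m p theta)) main_indices + l).
Proof.
  intros H0 Hl.
  assert (E : Rsum (fun p => pr (term m p theta)) main_indices =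
    Rsum (fun p => if is_main p then pr (term m p theta) else 0) main_indices)
    by easy.
  rewrite E.
  eapply is_Rsum_ext; [|apply is_Rsum_plus; [apply is_Rsum_finite|exact Hl]].
  - intros p. cbv beta. unfold rest. destruct (is_main p); [rewrite H0|]; ring.
  - apply NoDup_main_indices.
  - intros p Hp. destruct (is_main p) eqn:Hm; [|easy].
    now apply In_main_indices in Hm.
Qed.

Lemma snd_le_Cmod z : Rabs (snd z) <= Cmod z.
Proof. eapply Rle_trans; [apply Rmax_r | apply Rmax_Cmod]. Qed.

(** The sharper weights depend on [theta]; the slope estimates require one family dominating at
    every point of [inner], hence both weights large. *)
Lemma majorant_weights_uniform theta : majorant_weights 0.068 0.068 theta.
Proof. split; left; lra. Qed.

Lemma sum_le_majorant_pow n X Y : 0 <= X -> 0 <= Y ->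
  sum_le (fun p => majorant X Y p * (/ 1.19) ^ n)
    ((2 * (X + Y) + 0.015625) * (/ 1.19) ^ n).
Proof.
  intros HX HY.
  rewrite Rmult_comm.
  eapply sum_le_mono; [|apply sum_le_scal; [|now apply sum_le_majorant]].
  - intros p. rewrite Rmult_comm. apply Rle_refl.
  - apply pow_le. lra.
Qed.

Lemma is_Rsum_rest_ex n theta (pr : C -> R) : inner theta ->
  (forall z, Rabs (pr z) <= Cmod z) ->
  exists l, is_Rsum (fun p => pr (rest (31 + 2 * n) p theta)) l.
Proof.
  intros Ht Hpr.
  eapply is_Rsum_ex; [|apply (sum_le_majorant_pow n 0.068 0.068); lra].
  intros p. eapply Rle_trans; [apply Hpr|].
  apply rest_Cmod_le; [easy | apply majorant_weights_uniform].
Qed.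

Lemma chi_opp d : Z.odd d = true -> chi (- d) = - chi d.
Proof.
  intros Hd. apply Z.odd_spec in Hd. destruct Hd as [b ->].
  destruct (Z.Even_or_Odd b) as [[q ->] | [q ->]]; unfold chi.
  - replace ((2 * (2 * q) + 1) mod 4)%Z with 1%Z
      by (apply (Z.mod_unique _ _ q); lia).
    replace (- (2 * (2 * q) + 1) mod 4)%Z with 3%Z
      by (apply (Z.mod_unique _ _ (- q - 1)%Z); lia).
    simpl; ring.
  - replace ((2 * (2 * q + 1) + 1) mod 4)%Z with 3%Z
      by (apply (Z.mod_unique _ _ q); lia).
    replace (- (2 * (2 * q + 1) + 1) mod 4)%Z with 1%Z
      by (apply (Z.mod_unique _ _ (- q - 1)%Z); lia).
    simpl; ring.
Qed.

(* [(a, d) |-> (a, -d)] in the coordinates [a = c + d] *)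
Definition flip (p : Z * Z) : Z * Z := (fst p + 2 * snd p, - snd p)%Z.

Lemma flip_involutive p : flip (flip p) = p.
Proof. destruct p as [c d]. unfold flip. cbn [fst snd]. f_equal; lia. Qed.

Lemma E_index_flip p : E_index (flip p) = E_index p.
Proof.
  destruct p as [c d]. unfold E_index, flip. cbn [fst snd].
  rewrite Z.odd_opp, Z.even_add_mul_2. f_equal.
  rewrite Z.gcd_opp_r, Z.gcd_comm, (Z.gcd_comm c d).
  now rewrite Z.gcd_add_mult_diag_r.
Qed.

(** Changing the sign of [d] conjugates [lin] and negates [chi], so a term becomes minus its
    conjugate. *)
Lemma fst_term_flip m p theta : inner theta ->
  fst (term m (flip p) theta) = - fst (term m p theta).
Proof.
  intros Ht. unfold term. rewrite E_index_flip.
  destruct (E_index p) eqn:Hp; [|simpl; ring].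
  pose proof (lin_inner_neq_0 p theta Hp Ht) as Hl.
  destruct p as [c d]. unfold flip. cbn [fst snd] in *.
  destruct (E_index_spec _ _ Hp) as [_ [Hd _]].
  rewrite chi_opp by easy.
  replace (c + 2 * d + - d)%Z with (c + d)%Z by ring.
  replace (lin (IZR (c + d)) (IZR (- d)) (theta / 2)) with
    (Cconj (lin (IZR (c + d)) (IZR d) (theta / 2))).
  2:{ unfold Cconj, lin. rewrite opp_IZR. apply injective_projections; simpl; ring. }
  rewrite <- Cpow_conj.
  assert (Hu := Cpow_nz _ m Hl).
  set (u := (lin _ _ _ ^ m)%C) in *.
  destruct u as [x y]. unfold Cconj, Cinv. simpl.
  assert (x * (x * 1) + y * (y * 1) <> 0).
  { intros E. apply Hu. assert (x = 0) by nra. assert (y = 0) by nra.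
    now subst. }
  field. intros E. apply H. rewrite <- E. ring.
Qed.

Lemma expi_pow t n : (expi t ^ n)%C = expi (INR n * t).
Proof.
  induction n as [|n IH].
  - simpl. unfold expi. rewrite Rmult_0_l, cos_0, sin_0. easy.
  - rewrite Cpow_S, IH, S_INR. unfold expi.
    replace ((INR n + 1) * t) with (t + INR n * t) by ring.
    rewrite cos_plus, sin_plus. apply injective_projections; simpl; ring.
Qed.

Lemma inv_expi t : (/ expi t)%C = expi (- t).
Proof.
  assert (E : (expi t * expi (- t))%C = RtoC 1).
  { unfold expi. rewrite cos_neg, sin_neg. pose proof (sin2_cos2 t) as H.
    unfold Rsqr in H. apply injective_projections; simpl; lra. }
  pose proof (expi_neq_0 t) as H.
  rewrite <- (Cmult_1_r (/ expi t)), <- E. field. exact H.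
Qed.

Lemma Copp_pow_odd (u : C) n : ((- u) ^ (2 * n + 1) = - u ^ (2 * n + 1))%C.
Proof.
  rewrite !Cpow_add_r, !Cpow_mult_r, !Cpow_1_r.
  replace ((- u) ^ 2)%C with (u ^ 2)%C by (simpl; ring). ring.
Qed.

(** For these four pairs [lin] is a unit, plus or minus [expi t] or [expi (- t)], and the odd
    exponent lets the sign out of the power. *)
Lemma Rsum_main n theta :
  Rsum (fun p => snd (term (2 * n + 1) p theta)) main_indices =
  - 2 * sin (INR (2 * n + 1) * (theta / 2)).
Proof.
  set (m := (2 * n + 1)%nat).
  cbn [Rsum fold_right main_indices]. unfold term.
  cbn [fst snd].
  change (E_index (0, 1)%Z) with true. change (E_index (0, -1)%Z) with true.
  change (E_index (2, -1)%Z) with true. change (E_index (-2, 1)%Z) with true.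
  change (chi 1) with 1. change (chi (-1)) with (-1).
  change (0 + 1)%Z with 1%Z. change (0 + -1)%Z with (-1)%Z.
  change (2 + -1)%Z with 1%Z. change (-2 + 1)%Z with (-1)%Z.
  set (t := theta / 2).
  replace (lin 1 1 t) with (- expi (- t))%C.
  2:{ unfold lin, expi. rewrite cos_neg, sin_neg.
      apply injective_projections; simpl; ring. }
  replace (lin (-1) (-1) t) with (expi (- t))%C.
  2:{ unfold lin, expi. rewrite cos_neg, sin_neg.
      apply injective_projections; simpl; ring. }
  replace (lin 1 (-1) t) with (- expi t)%C.
  2:{ unfold lin, expi. apply injective_projections; simpl; ring. }
  replace (lin (-1) 1 t) with (expi t)%C.
  2:{ unfold lin, expi. apply injective_projections; simpl; ring. }
  unfold m. rewrite !Copp_pow_odd. fold m. rewrite !expi_pow.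
  assert (Hi : forall x, (/ (- expi x) = - expi (- x))%C).
  { intros x. rewrite <- inv_expi. field. apply expi_neq_0. }
  rewrite !Hi, !inv_expi.
  replace (- (INR m * - t)) with (INR m * t) by ring.
  unfold expi. rewrite sin_neg. simpl. field.
Qed.

(** Defined from [F] itself, hence for every [theta]; on [inner] it is the sum of the imaginary
    parts of [rest]. *)
Definition remainder (m : nat) (theta : R) : R :=
  snd (F m theta) + 2 * sin (INR m * (theta / 2)).

Lemma F_main_remainder n theta : inner theta ->
  F (31 + 2 * n) theta =
    (0, - 2 * sin (INR (31 + 2 * n) * (theta / 2)) + remainder (31 + 2 * n) theta) /\
  is_Rsum (fun p => snd (rest (31 + 2 * n) p theta)) (remainder (31 + 2 * n) theta).
Proof.
  intros Ht.
  destruct (is_Rsum_rest_ex n theta fst Ht re_le_Cmod) as [x Hx].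
  destruct (is_Rsum_rest_ex n theta snd Ht snd_le_Cmod) as [y Hy].
  assert (Hy0 := Hy).
  apply is_Rsum_term in Hx; [|easy]. apply is_Rsum_term in Hy; [|easy].
  set (x' := _ + x) in Hx. set (y' := _ + y) in Hy.
  assert (Hx0 : x' = 0).
  { assert (x' = -1 * x'); [|lra].
    apply (is_Rsum_unique (fun p => fst (term (31 + 2 * n) (flip p) theta))).
    - apply (is_Rsum_involution _ _ flip flip_involutive Hx).
    - eapply is_Rsum_ext; [|apply is_Rsum_scal, Hx].
      intros p. cbv beta. rewrite fst_term_flip by easy. ring. }
  pose proof (F_eq_sum _ theta x' y' (inner_0_PI _ Ht) Hx Hy) as HF.
  assert (Hy' : y' = - 2 * sin (INR (31 + 2 * n) * (theta / 2)) + y).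
  { unfold y'. f_equal.
    replace (31 + 2 * n)%nat with (2 * (15 + n) + 1)%nat by lia.
    apply Rsum_main. }
  assert (Hr : remainder (31 + 2 * n) theta = y).
  { unfold remainder. rewrite HF. cbn [snd]. rewrite Hy'. ring. }
  rewrite Hr. split; [|easy]. rewrite HF, Hx0, Hy'. easy.
Qed.

Lemma remainder_le n theta : inner theta ->
  Rabs (remainder (31 + 2 * n) theta) <= 0.153 * (/ 1.19) ^ n.
Proof.
  intros Ht. destruct (inner_trig theta Ht) as [H1 [H2 H3]].
  (* One of [sin^2], [cos^2] is at least 1/2, so only one weight has to be large; then
     [2 * 0.0682 + 0.015625 < 0.153]. *)
  assert (HXY : exists X Y, majorant_weights X Y theta /\ X + Y <= 0.0682).
  { destruct (Rle_lt_dec (1 / 2) (sin (theta / 2) ^ 2)).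
    - exists 0.0001, 0.068. unfold majorant_weights. split; [|lra].
      split; [right | left]; lra.
    - exists 0.068, 0.0001. unfold majorant_weights. split; [|lra].
      split; [left | right]; lra. }
  destruct HXY as [X [Y [HXY HXYs]]].
  assert (HX : 0 <= X) by (destruct HXY; lra).
  assert (HY : 0 <= Y) by (destruct HXY; lra).
  apply Rle_trans with ((2 * (X + Y) + 0.015625) * (/ 1.19) ^ n).
  - eapply is_Rsum_abs_le; [|now apply (sum_le_majorant_pow n X Y)|
      apply F_main_remainder, Ht].
    intros p. eapply Rle_trans; [apply snd_le_Cmod | now apply rest_Cmod_le].
  - apply Rmult_le_compat_r; [apply pow_le; lra | lra].
Qed.

(** * Slope of the remainder *)

Definition is_dC (f : R -> C) (x : R) (l : C) : Prop :=
  is_derive (fun t => fst (f t)) x (fst l) /\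
  is_derive (fun t => snd (f t)) x (snd l).

Lemma is_derive_Rmult (f g : R -> R) x lf lg :
  is_derive f x lf -> is_derive g x lg ->
  is_derive (fun t => f t * g t) x (lf * g x + f x * lg).
Proof. intros Hf Hg. exact (is_derive_mult f g x lf lg Hf Hg Rmult_comm). Qed.

Lemma is_derive_eq (f : R -> R) x (l l' : R) :
  l = l' -> is_derive f x l -> is_derive f x l'.
Proof. now intros ->. Qed.

Lemma is_dC_mult f g x lf lg :
  is_dC f x lf -> is_dC g x lg ->
  is_dC (fun t => f t * g t)%C x (lf * g x + f x * lg)%C.
Proof.
  intros [f1 f2] [g1 g2]. split.
  - eapply is_derive_eq; [|exact (is_derive_minus _ _ _ _ _
      (is_derive_Rmult _ _ _ _ _ f1 g1) (is_derive_Rmult _ _ _ _ _ f2 g2))].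
    unfold minus, plus, opp; simpl. ring.
  - eapply is_derive_eq; [|exact (is_derive_plus _ _ _ _ _
      (is_derive_Rmult _ _ _ _ _ f1 g2) (is_derive_Rmult _ _ _ _ _ f2 g1))].
    unfold plus; simpl. ring.
Qed.

Lemma is_dC_const c x : is_dC (fun _ => c) x (RtoC 0).
Proof. split; apply (is_derive_const (K := R_AbsRing) (V := R_NormedModule)). Qed.

Lemma is_dC_eq f x l l' : l = l' -> is_dC f x l -> is_dC f x l'.
Proof. now intros ->. Qed.

Lemma is_dC_pow f x l n : is_dC f x l ->
  is_dC (fun t => f t ^ S n)%C x (INR (S n) * f x ^ n * l)%C.
Proof.
  intros Hf. induction n as [|n IH].
  - apply is_dC_eq with (l * f x ^ 0 + f x * RtoC 0)%C.
    + simpl. ring.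
    + exact (is_dC_mult f (fun t => f t ^ 0)%C x l (RtoC 0) Hf (is_dC_const 1 x)).
  - apply is_dC_eq with (l * f x ^ S n + f x * (INR (S n) * f x ^ n * l))%C.
    + rewrite (S_INR (S n)), RtoC_plus, !Cpow_S. ring.
    + exact (is_dC_mult f (fun t => f t ^ S n)%C x l _ Hf IH).
Qed.

(** Componentwise, [1 / f] is the conjugate of [f] divided by [D], the squared modulus, so the real
    quotient rule applies. *)
Lemma is_dC_inv f x l : f x <> RtoC 0 -> is_dC f x l ->
  is_dC (fun t => / f t)%C x (- l / (f x * f x))%C.
Proof.
  intros Hx [f1 f2].
  set (D := fun t => fst (f t) ^ 2 + snd (f t) ^ 2).
  assert (HD : D x <> 0).
  { intros H. apply Hx. unfold D in H.
    assert (fst (f x) = 0) by nra. assert (snd (f x) = 0) by nra.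
    now apply injective_projections. }
  assert (dD : is_derive D x (2 * fst (f x) * fst l + 2 * snd (f x) * snd l)).
  { eapply is_derive_eq; [|exact (is_derive_plus _ _ _ _ _
      (is_derive_pow _ 2 _ _ f1) (is_derive_pow _ 2 _ _ f2))].
    unfold plus; simpl. ring. }
  assert (HE : fst (f x) ^ 2 + snd (f x) ^ 2 <> 0) by exact HD.
  (* The squared modulus of [f x * f x], the denominator in the claimed derivative; it equals
     [D x ^ 2]. *)
  assert (HE' : ((fst (f x) * fst (f x) - snd (f x) * snd (f x)) ^ 2 +
    (fst (f x) * snd (f x) + snd (f x) * fst (f x)) ^ 2) <> 0).
  { replace (_ + _) with ((fst (f x) ^ 2 + snd (f x) ^ 2) ^ 2) by ring.
    now apply pow_nonzero. }
  split.
  - eapply is_derive_eq; [|exact (is_derive_div _ _ _ _ _ f1 dD HD)].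
    unfold D. unfold Cdiv, Cinv, Cmult, Copp. cbn [fst snd].
    field. split; easy.
  - eapply is_derive_eq; [|exact (is_derive_div _ _ _ _ _
      (is_derive_opp _ _ _ f2) dD HD)].
    unfold D, opp. simpl AbelianGroup.opp.
    unfold Cdiv, Cinv, Cmult, Copp. cbn [fst snd].
    field. split; easy.
Qed.

Definition dlin (a d t : R) : C := (/ 2 * (a * sin t), / 2 * (d * cos t)).

Lemma is_dC_lin a d theta :
  is_dC (fun t => lin a d (t / 2)) theta (dlin a d (theta / 2)).
Proof.
  unfold lin, dlin. split; cbn [fst snd].
  - auto_derive; [easy|]. unfold Rdiv. field.
  - auto_derive; [easy|]. unfold Rdiv. field.
Qed.

(** Differentiation exchanges sine and cosine and halves, so the squared ratio is at most a quarter
    of the larger of [tan^2] and [cot^2]. Both are at most [0.9762 / 0.0238 < 41.05], and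
    [sqrt 41.05 / 2 < 3.205]. *)
Lemma Cmod_dlin_le a d theta : inner theta ->
  Cmod (dlin a d (theta / 2)) <= 3.205 * Cmod (lin a d (theta / 2)).
Proof.
  intros Ht. destruct (inner_trig theta Ht) as [H1 [H2 H3]].
  apply Rsqr_incr_0_var.
  2:{ pose proof (Cmod_ge_0 (lin a d (theta / 2))). lra. }
  rewrite !Rsqr_pow2, Rpow_mult_distr, Cmod_lin_sqr.
  unfold Cmod, dlin. cbn [fst snd].
  rewrite pow2_sqrt by (apply Rplus_le_le_0_compat; apply pow2_ge_0).
  replace (_ + _) with (/ 4 * (a ^ 2 * sin (theta / 2) ^ 2 +
    d ^ 2 * cos (theta / 2) ^ 2)) by field.
  set (s := sin (theta / 2) ^ 2) in *. set (c := cos (theta / 2) ^ 2) in *.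
  pose proof (pow2_ge_0 a) as Ha. pose proof (pow2_ge_0 d) as Hd.
  assert (a ^ 2 * s <= a ^ 2 * (41.05 * c)) by (apply Rmult_le_compat_l; lra).
  assert (d ^ 2 * c <= d ^ 2 * (41.05 * s)) by (apply Rmult_le_compat_l; lra).
  assert (0 <= a ^ 2 * c) by (apply Rmult_le_pos; lra).
  assert (0 <= d ^ 2 * s) by (apply Rmult_le_pos; lra).
  lra.
Qed.

(** The logarithmic derivative of [u ^ m] is [m u' / u], so differentiating a term costs only the
    factor [3.205 m]. *)
Lemma term_derive m p theta : inner theta -> E_index p = true ->
  exists D : C, is_dC (term (S m) p) theta D /\
    Cmod D <= INR (S m) * 3.205 * (/ 2 *
      / Cmod (lin (IZR (fst p + snd p)) (IZR (snd p)) (theta / 2)) ^ S m).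
Proof.
  intros Ht Hp. pose proof (lin_inner_neq_0 p theta Hp Ht) as Hl.
  set (a := IZR (fst p + snd p)) in *. set (d := IZR (snd p)) in *.
  set (k := (/ 2 * chi (snd p))%C).
  pose proof (is_dC_lin a d theta) as Du.
  pose proof (Cmod_dlin_le a d theta Ht) as Hu'.
  set (u' := dlin a d (theta / 2)) in *.
  pose proof (is_dC_pow _ _ _ m Du) as Dp. cbv beta in Dp.
  pose proof (is_dC_inv (fun t => lin a d (t / 2) ^ S m)%C _ _
    (Cpow_nz _ (S m) Hl) Dp) as Di. cbv beta in Di.
  pose proof (is_dC_mult (fun _ => k) (fun t => / lin a d (t / 2) ^ S m)%C
    _ _ _ (is_dC_const k theta) Di) as Dt. cbv beta in Dt.
  set (u := lin a d (theta / 2)) in *.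
  set (D := (_ + _)%C) in Dt.
  exists D. split.
  - assert (E : forall t, (k * / lin a d (t / 2) ^ S m)%C = term (S m) p t).
    { intros t. unfold term. rewrite Hp. reflexivity. }
    destruct Dt as [D1 D2].
    split; eapply is_derive_ext; try eassumption; intros t; cbv beta; now rewrite E.
  - assert (HN : 0 < Cmod u) by now apply Cmod_gt_0.
    assert (HNm : 0 < Cmod u ^ m) by now apply pow_lt.
    assert (Hum : (u ^ S m)%C <> RtoC 0) by now apply Cpow_nz.
    assert (HD : D = (- (k * INR (S m) * u ^ m * u' * / (u ^ S m * u ^ S m)))%C).
    { unfold D, Cdiv. ring. }
    rewrite HD, Cmod_opp, !Cmod_mult, Cmod_inv by now apply Cmult_neq_0.
    rewrite Cmod_mult, Cmod_R, !Cmod_pow.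
    rewrite (Rabs_right (INR (S m))) by (apply Rle_ge, pos_INR).
    pose proof (Cmod_half_chi (snd p)) as Hk. fold k in Hk.
    pose proof (pos_INR (S m)) as Hm.
    set (N := Cmod u) in *.
    apply Rle_trans with
      (/ 2 * INR (S m) * N ^ m * (3.205 * N) * / (N ^ S m * N ^ S m)).
    + assert (H0 : 0 < N ^ S m) by now apply pow_lt.
      apply Rmult_le_compat_r.
      { left. apply Rinv_0_lt_compat. now apply Rmult_lt_0_compat. }
      apply Rmult_le_compat; try easy; try apply Cmod_ge_0.
      * repeat apply Rmult_le_pos; try easy; try apply Cmod_ge_0. now left.
      * repeat (apply Rmult_le_compat_r; [first [easy | now left]|]). easy.
    + right. rewrite <- !tech_pow_Rmult. field. split; lra.
Qed.

(** The slope of the main term is also proportional to [m], so the geometric factor is simply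
    estimated by 1. *)
Lemma rest_derive n p theta : inner theta ->
  exists D : R, is_derive (fun t => snd (rest (31 + 2 * n) p t)) theta D /\
    Rabs D <= INR (31 + 2 * n) * 3.205 * majorant 0.068 0.068 p.
Proof.
  intros Ht.
  assert (HM : 0 <= majorant 0.068 0.068 p) by (apply majorant_nonneg; lra).
  assert (HB : 0 <= INR (31 + 2 * n) * 3.205 * majorant 0.068 0.068 p).
  { apply Rmult_le_pos; [|easy]. pose proof (pos_INR (31 + 2 * n)). lra. }
  assert (H0 : (forall t, rest (31 + 2 * n) p t = RtoC 0) ->
    exists D : R, is_derive (fun t => snd (rest (31 + 2 * n) p t)) theta D /\
    Rabs D <= INR (31 + 2 * n) * 3.205 * majorant 0.068 0.068 p).
  { intros E. exists 0. rewrite Rabs_R0. split; [|easy].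
    apply is_derive_ext with (fun _ => 0).
    - intros t. now rewrite E.
    - apply (is_derive_const (K := R_AbsRing) (V := R_NormedModule)). }
  destruct (is_main p) eqn:Hm; [|destruct (E_index p) eqn:Hp].
  - apply H0. intros t. unfold rest. now rewrite Hm.
  - destruct (term_derive (30 + 2 * n) p theta Ht Hp) as [D [[_ D1] D2]].
    change (S (30 + 2 * n)) with (31 + 2 * n)%nat in *.
    exists (snd D). split.
    + apply is_derive_ext with (2 := D1).
      intros t. unfold rest. now rewrite Hm.
    + eapply Rle_trans; [apply snd_le_Cmod|].
      eapply Rle_trans; [exact D2|].
      apply Rmult_le_compat_l; [pose proof (pos_INR (31 + 2 * n)); lra|].
      eapply Rle_trans; [apply (inv_Cmod_lin_le_majorant n p theta 0.068 0.068);
        auto using majorant_weights_uniform|].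
      rewrite <- (Rmult_1_r (majorant _ _ _)) at 2.
      apply Rmult_le_compat_l; [easy|].
      rewrite <- (pow1 n). apply pow_incr. lra.
  - apply H0. intros t. unfold rest, term. rewrite Hm, Hp. easy.
Qed.

(** The difference quotient completed by [l] at [x]: the form of cofactor that [has_order] asks
    for. *)
Definition slope (f : R -> R) (x l t : R) : R :=
  if Req_EM_T t x then l else (f t - f x) / (t - x).

Lemma slope_eq f x l t : f t - f x = (t - x) * slope f x l t.
Proof.
  unfold slope. destruct (Req_EM_T t x) as [->|H]; [ring|]. field. lra.
Qed.

Lemma slope_diag f x l : slope f x l x = l.
Proof. unfold slope. now destruct (Req_EM_T x x). Qed.

Lemma continuous_slope f x l : is_derive f x l -> continuous (slope f x l) x.
Proof.
  intros H. apply is_derive_Reals in H.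
  apply continuity_pt_filterlim. intros eps He.
  destruct (H eps He) as [delta Hd].
  exists delta. split; [apply cond_pos|].
  intros t [[_ Hxt] Ht]. rewrite slope_diag. unfold slope.
  destruct (Req_EM_T t x) as [E|_]; [now symmetry in E|].
  simpl in *. unfold Rdist in *.
  specialize (Hd (t - x)). replace (x + (t - x)) with t in Hd by ring.
  apply Hd; [lra | easy].
Qed.

Lemma inner_between x y c : inner x -> inner y ->
  Rmin x y <= c <= Rmax x y -> inner c.
Proof.
  unfold inner, Rmin, Rmax. destruct (Rle_dec x y); lra.
Qed.

Lemma slope_le f x l B t : inner x -> inner t -> is_derive f x l ->
  (forall c, inner c -> exists D, is_derive f c D /\ Rabs D <= B) ->
  Rabs (slope f x l t) <= B.
Proof.
  intros Hx Ht Hl HB. unfold slope. destruct (Req_EM_T t x) as [E|E].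
  - destruct (HB x Hx) as [D [HD1 HD2]].
    apply is_derive_unique in Hl. apply is_derive_unique in HD1. congruence.
  - destruct (MVT_gen f x t (Derive f)) as [c [Hc1 Hc2]].
    + intros c Hc. apply Derive_correct.
      destruct (HB c) as [D [HD _]]; [|now exists D].
      apply (inner_between x t); [easy | easy | lra].
    + intros c Hc. destruct (HB c) as [D [HD _]].
      { now apply (inner_between x t). }
      apply derivable_continuous_pt. exists D. now apply is_derive_Reals.
    + rewrite Hc2. replace (Derive f c * (t - x) / (t - x)) with (Derive f c)
        by (field; lra).
      destruct (HB c) as [D [HD1 HD2]]; [now apply (inner_between x t)|].
      apply is_derive_unique in HD1. rewrite HD1. easy.
Qed.

Lemma locally_inner x : inner x -> locally x inner.
Proof.
  exact (open_and _ _ (open_gt 0.31) (open_lt (PI - 0.31)) x).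
Qed.

(** The quotients of the terms are dominated by the summable [b], and each is continuous at [x], so
    the M-test applies to their sum [q]. The constant comes from
    [3.205 * (2 * 0.136 + 0.015625) < 0.925]. *)
Lemma remainder_slope n x : inner x ->
  exists q : R -> R, continuous q x /\ forall t, inner t ->
    remainder (31 + 2 * n) t - remainder (31 + 2 * n) x = (t - x) * q t /\
    Rabs (q t) <= 0.925 * INR (31 + 2 * n).
Proof.
  intros Hx. set (m := (31 + 2 * n)%nat).
  set (b := fun p => INR m * 3.205 * majorant 0.068 0.068 p).
  assert (Hm : 0 <= INR m) by apply pos_INR.
  assert (HB : sum_le b (0.925 * INR m)).
  { intros s Hs. eapply Rle_trans.
    - apply (sum_le_scal (INR m * 3.205) (majorant 0.068 0.068)
        (2 * (0.068 + 0.068) + 0.015625)); [lra | apply sum_le_majorant; lra | easy].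
    - lra. }
  set (r := fun p t => snd (rest m p t)).
  set (D := fun p => Derive (r p) x).
  assert (HD : forall p, is_derive (r p) x (D p)).
  { intros p. apply Derive_correct.
    destruct (rest_derive n p x Hx) as [l [Hl _]]. now exists l. }
  assert (Hb : forall p t, inner t -> Rabs (slope (r p) x (D p) t) <= b p).
  { intros p t Ht. apply slope_le; try easy. intros c Hc. now apply rest_derive. }
  (* [l] is the sum of the derivatives of the terms at [x], the value that makes [q] continuous
     there. *)
  destruct (is_Rsum_ex (fun p => slope (r p) x (D p) x) b (0.925 * INR m))
    as [l Hl]; [now intros p; apply Hb | easy |].
  set (q := slope (remainder m) x l).
  assert (Hq : forall t, inner t -> is_Rsum (fun p => slope (r p) x (D p) t) (q t)).
  { intros t Ht. destruct (Req_EM_T t x) as [->|E].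
    - unfold q. now rewrite slope_diag.
    - destruct (F_main_remainder n t Ht) as [_ H1].
      destruct (F_main_remainder n x Hx) as [_ H2]. fold m in H1, H2.
      apply (is_Rsum_scal (-1)) in H2.
      pose proof (is_Rsum_plus _ _ _ _ H1 H2) as H3.
      apply (is_Rsum_scal (/ (t - x))) in H3.
      unfold q, slope. destruct (Req_EM_T t x) as [E'|_]; [easy|].
      replace ((remainder m t - remainder m x) / (t - x)) with
        (/ (t - x) * (remainder m t + -1 * remainder m x)) by (field; lra).
      eapply is_Rsum_ext; [|exact H3].
      intros p. unfold r. cbv beta. field. lra. }
  exists q. split.
  - apply (continuous_is_Rsum (fun p t => slope (r p) x (D p) t) b _ q x HB).
    + generalize (locally_inner x Hx). apply filter_imp. intros t Ht. split.
      * intros p. now apply Hb.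
      * now apply Hq.
    + intros p. apply continuous_slope, HD.
  - intros t Ht. split; [apply slope_eq|].
    apply (is_Rsum_abs_le (fun p => slope (r p) x (D p) t) b); auto.
Qed.

(** * Zeros and intervals *)

(** The half-width [PI / (m + 2)] of the intervals in the phase [m theta / 2], where [m = 31 + 2 n];
    in this variable the centres are the multiples of [PI]. *)
Definition gap (n : nat) : R := PI / (33 + 2 * INR n).

Lemma INR_weight n : INR (31 + 2 * n) = 31 + 2 * INR n.
Proof.
  rewrite plus_INR, mult_INR. simpl (INR 2).
  rewrite (INR_IZR_INZ 31). simpl. ring.
Qed.

Lemma INR_16_add n : INR (16 + n) = 16 + INR n.
Proof. rewrite plus_INR, (INR_IZR_INZ 16). simpl. ring. Qed.

Lemma gap_bounds n : 0 < gap n <= 4 / 33 /\ 3.1 <= gap n * (33 + 2 * INR n).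
Proof.
  pose proof PI_gt_3_1. pose proof PI_4. pose proof (pos_INR n).
  assert (E : gap n * (33 + 2 * INR n) = PI) by (unfold gap; field; lra).
  rewrite E. repeat split; try lra.
  - apply Rdiv_lt_0_compat; lra.
  - unfold gap. apply Rle_trans with (PI / 33); [|lra].
    apply Rmult_le_compat_l; [lra|]. apply Rinv_le_contravar; lra.
Qed.

(** Bernoulli's inequality [1.19^n >= 1 + 0.19 n] reduces the comparison of exponential with
    harmonic decay to linear polynomials in [n], tightest at [n = 0]:
    [0.153 * 33 < 2 * 0.99 * 3.1]. *)
Lemma remainder_lt n theta : inner theta ->
  Rabs (remainder (31 + 2 * n) theta) < 2 * sin (gap n).
Proof.
  intros Ht. eapply Rle_lt_trans; [now apply remainder_le|].
  destruct (gap_bounds n) as [[H1 H2] H3].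
  pose proof (pos_INR n) as Hn.
  pose proof (sin_ge_cubic (gap n)) as Hs.
  assert (H4 : 0.99 * gap n <= sin (gap n)).
  { eapply Rle_trans; [|apply Hs; lra].
    assert (gap n ^ 2 <= 0.015) by nra.
    assert (gap n ^ 3 <= 0.015 * gap n); [|lra].
    replace (gap n ^ 3) with (gap n ^ 2 * gap n) by ring.
    apply Rmult_le_compat_r; lra. }
  rewrite pow_inv.
  pose proof (poly n 0.19 ltac:(lra)) as Hp.
  replace (1 + 0.19) with 1.19 in Hp by lra.
  set (P := 1.19 ^ n) in *. set (x := INR n) in *. set (g := gap n) in *.
  apply Rle_lt_trans with (0.153 / (1 + x * 0.19)).
  - apply Rmult_le_compat_l; [lra|]. apply Rinv_le_contravar; lra.
  - apply Rlt_le_trans with (2 * (0.99 * g)); [|lra].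
    apply Rmult_lt_reg_r with ((1 + x * 0.19) * (33 + 2 * x)); [nra|].
    replace (0.153 / (1 + x * 0.19) * ((1 + x * 0.19) * (33 + 2 * x))) with
      (0.153 * (33 + 2 * x)) by (field; lra).
    replace (2 * (0.99 * g) * ((1 + x * 0.19) * (33 + 2 * x))) with
      (2 * 0.99 * (1 + x * 0.19) * (g * (33 + 2 * x))) by ring.
    apply Rlt_le_trans with (2 * 0.99 * (1 + x * 0.19) * 3.1); [lra|].
    apply Rmult_le_compat_l; lra.
Qed.

Lemma Ival_iff n j theta : Ival (16 + n) j theta <->
  Rabs (INR (31 + 2 * n) * (theta / 2) - INR j * PI) < gap n.
Proof.
  unfold Ival, alpha, gap. rewrite INR_weight, INR_16_add.
  pose proof (pos_INR n) as Hn. set (x := INR n) in *.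
  replace (2 * (16 + x) + 1) with (33 + 2 * x) by ring.
  replace (2 * (16 + x) - 1) with (31 + 2 * x) by ring.
  set (M := 31 + 2 * x). set (M' := 33 + 2 * x).
  assert (HM : 0 < M) by (unfold M; lra). assert (HM' : 0 < M') by (unfold M'; lra).
  replace (2 * PI / (M' * M)) with (2 / M * (PI / M')) by (field; lra).
  replace (2 * PI * INR j / M) with (2 / M * (INR j * PI)) by (field; lra).
  assert (E : theta = 2 / M * (M * (theta / 2))) by (field; lra).
  assert (H2 : 0 < 2 / M) by (apply Rdiv_lt_0_compat; lra).
  set (y := M * (theta / 2)) in *. set (c := INR j * PI). set (g := PI / M').
  rewrite E. split.
  - intros [Ha Hb]. apply Rabs_def1; apply (Rmult_lt_reg_l (2 / M)); lra.
  - intros H. apply Rabs_def2 in H. destruct H as [Ha Hb].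
    apply (Rmult_lt_compat_l (2 / M)) in Ha; [|easy].
    apply (Rmult_lt_compat_l (2 / M)) in Hb; [|easy]. lra.
Qed.

Lemma sin_add_nat_PI y j : sin (y + INR j * PI) = (-1) ^ j * sin y.
Proof.
  induction j as [|j IH].
  - simpl. rewrite Rmult_0_l, Rplus_0_r. ring.
  - rewrite S_INR. replace (y + (INR j + 1) * PI) with (y + INR j * PI + PI) by ring.
    rewrite neg_sin, IH. simpl. ring.
Qed.

Lemma cos_add_nat_PI y j : cos (y + INR j * PI) = (-1) ^ j * cos y.
Proof.
  induction j as [|j IH].
  - simpl. rewrite Rmult_0_l, Rplus_0_r. ring.
  - rewrite S_INR. replace (y + (INR j + 1) * PI) with (y + INR j * PI + PI) by ring.
    rewrite neg_cos, IH. simpl. ring.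
Qed.

Lemma Rabs_sign_mult j x : Rabs ((-1) ^ j * x) = Rabs x.
Proof. now rewrite Rabs_mult, pow_1_abs, Rmult_1_l. Qed.

Lemma cos_near_nat_PI n j y : Rabs (y - INR j * PI) < gap n -> 0.99 <= Rabs (cos y).
Proof.
  intros H. destruct (gap_bounds n) as [[H1 H2] _].
  replace y with ((y - INR j * PI) + INR j * PI) by ring.
  rewrite cos_add_nat_PI, Rabs_sign_mult.
  set (z := y - INR j * PI) in *. apply Rabs_def2 in H.
  eapply Rle_trans; [|apply Rle_abs].
  eapply Rle_trans; [|apply cos_ge_quadratic; lra].
  assert (z ^ 2 <= 0.02) by nra. lra.
Qed.

Lemma sin_lt_near_multiple y g : 0 <= y -> 0 < g < PI / 2 ->
  Rabs (sin y) < sin g -> exists j : nat, Rabs (y - INR j * PI) < g.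
Proof.
  intros Hy Hg Hs. pose proof PI_RGT_0 as HPI.
  assert (exists j : nat, - (PI / 2) <= y - INR j * PI <= PI / 2) as [j Hj].
  { destruct (archimed (y / PI - / 2)) as [A1 A2].
    (* An integer nearest to [y / PI]; it exceeds -1 because [y >= 0], so it is a natural number. *)
    set (z := up (y / PI - / 2)) in *.
    assert (Hz : (0 <= z)%Z).
    { apply le_IZR. assert (0 <= y / PI).
      { apply Rmult_le_pos; [easy|]. left. now apply Rinv_0_lt_compat. }
      assert (-1 < IZR z) by lra. apply IZR_le. apply lt_IZR in H0. lia. }
    exists (Z.to_nat z). rewrite INR_IZR_INZ, Z2Nat.id by easy.
    assert (E : y = y / PI * PI) by (field; lra).
    set (w := y / PI) in *. rewrite E.
    assert (- / 2 <= w - IZR z <= / 2) by lra. split; nra. }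
  exists j. set (z := y - INR j * PI) in *.
  replace y with (z + INR j * PI) in Hs by (unfold z; ring).
  rewrite sin_add_nat_PI, Rabs_sign_mult in Hs. apply Rabs_def2 in Hs.
  destruct Hs as [H1 H2]. rewrite <- sin_neg in H2.
  apply Rabs_def1.
  - apply (sin_increasing_0 z g); lra.
  - apply (sin_increasing_0 (- g) z); lra.
Qed.

Lemma gap_lt_PI2 n : gap n < PI / 2.
Proof. destruct (gap_bounds n). pose proof PI_gt_3_1. lra. Qed.

Lemma F_zero_located n theta : range theta ->
  F (31 + 2 * n) theta = RtoC 0 -> Iunion (16 + n) theta.
Proof.
  intros Hr HF. pose proof (range_inner _ Hr) as Ht.
  destruct (F_main_remainder n theta Ht) as [HE _].
  rewrite HF in HE. apply (f_equal snd) in HE. cbn [snd RtoC] in HE.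
  pose proof (remainder_lt n theta Ht) as Hlt.
  set (y := INR (31 + 2 * n) * (theta / 2)) in *.
  destruct (gap_bounds n) as [[H1 H2] _]. pose proof (gap_lt_PI2 n).
  pose proof (pos_INR (31 + 2 * n)) as HM.
  destruct (sin_lt_near_multiple y (gap n)) as [j Hj].
  - unfold y. apply Rmult_le_pos; [easy|]. destruct Ht; lra.
  - lra.
  - replace (remainder (31 + 2 * n) theta) with (2 * sin y) in Hlt by lra.
    rewrite Rabs_mult, (Rabs_right 2) in Hlt by lra. lra.
  - exists j. split; [|now apply Ival_iff].
    (* From [theta <= 9 PI / 10], [j PI] is less than [0.45 (31 + 2 n) PI + gap n], well below
       [(16 + n) PI]. *)
    apply INR_lt. rewrite INR_16_add. apply Rabs_def2 in Hj.
    unfold range in Hr. unfold y in Hj. rewrite INR_weight in *.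
    pose proof (pos_INR n) as Hn. pose proof PI_gt_3_1.
    apply Rmult_lt_reg_r with PI; [lra|].
    assert ((31 + 2 * INR n) * (theta / 2) <= (31 + 2 * INR n) * (9 * PI / 10 / 2))
      by (apply Rmult_le_compat_l; lra).
    assert (INR n * PI >= 0) by (apply Rle_ge, Rmult_le_pos; lra).
    lra.
Qed.

Lemma main_term_derive (m : nat) x :
  is_derive (fun t => - 2 * sin (INR m * (t / 2))) x (- INR m * cos (INR m * (x / 2))).
Proof. auto_derive; [easy|]. unfold Rdiv. field. Qed.

Lemma continuous_remainder n x : inner x -> continuous (remainder (31 + 2 * n)) x.
Proof.
  intros Hx. destruct (remainder_slope n x Hx) as [q [Hq Hr]].
  apply (continuous_ext_loc _
    (fun t => remainder (31 + 2 * n) x + (t - x) * q t)).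
  - generalize (locally_inner x Hx). apply filter_imp. intros t Ht.
    destruct (Hr t Ht) as [E _]. lra.
  - apply (continuous_plus (fun _ => remainder (31 + 2 * n) x)
      (fun t => (t - x) * q t)); [apply continuous_const|].
    apply (continuous_mult (fun t => t - x) q); [|easy].
    apply (continuous_minus (fun t => t) (fun _ => x));
      [apply continuous_id | apply continuous_const].
Qed.

Definition height (m : nat) (t : R) : R :=
  - 2 * sin (INR m * (t / 2)) + remainder m t.

Lemma F_height n t : inner t ->
  F (31 + 2 * n) t = (0, height (31 + 2 * n) t).
Proof. intros Ht. apply F_main_remainder, Ht. Qed.

Lemma INR_weight_pos n : 0 < INR (31 + 2 * n).
Proof. rewrite INR_weight. pose proof (pos_INR n). lra. Qed.

Lemma Ival_between n j x y c : Ival (16 + n) j x -> Ival (16 + n) j y ->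
  Rmin x y <= c <= Rmax x y -> Ival (16 + n) j c.
Proof.
  unfold Ival, Rmin, Rmax. destruct (Rle_dec x y); lra.
Qed.

(* With [m = 31 + 2 n], the main term has slope at least [0.99 m] in absolute
   value on the interval, whereas the remainder is [0.925 m]-Lipschitz. *)
Lemma height_slope n j x : inner x -> Ival (16 + n) j x ->
  exists g : R -> R, continuous g x /\
    (forall t, inner t ->
       height (31 + 2 * n) t - height (31 + 2 * n) x = (t - x) * g t) /\
    (forall t, inner t -> Ival (16 + n) j t -> g t <> 0).
Proof.
  intros Hx Hxi. pose proof (INR_weight_pos n) as HM.
  set (m := (31 + 2 * n)%nat) in *. set (M := INR m) in *.
  destruct (remainder_slope n x Hx) as [q [Hq Hr]]. fold m M in Hr.
  set (f := fun t => - 2 * sin (M * (t / 2))).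
  set (f' := fun t => - M * cos (M * (t / 2))).
  assert (Hf : forall t, is_derive f t (f' t)) by (intros; apply main_term_derive).
  exists (fun t => slope f x (f' x) t + q t). repeat split.
  - apply (continuous_plus (slope f x (f' x)) q); [now apply continuous_slope | easy].
  - intros t Ht. destruct (Hr t Ht) as [E _].
    pose proof (slope_eq f x (f' x) t). unfold height.
    fold M. unfold f in *. lra.
  - intros t Ht Hti. destruct (Hr t Ht) as [_ Hqt].
    assert (Hs : 0.99 * M <= Rabs (slope f x (f' x) t)).
    (* The mean value point stays between [x] and [t], hence in the same interval, where the cosine
       is at least 0.99 in absolute value. *)
    { assert (exists c, Ival (16 + n) j c /\ slope f x (f' x) t = f' c) as [c [Hc ->]].
      { unfold slope. destruct (Req_EM_T t x) as [E|E]; [now exists x|].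
        destruct (MVT_gen f x t f') as [c [Hc1 Hc2]].
        - intros c _. apply Hf.
        - intros c _. apply derivable_continuous_pt. exists (f' c).
          now apply is_derive_Reals.
        - exists c. split; [now apply (Ival_between n j x t)|].
          rewrite Hc2. field. lra. }
      apply Ival_iff in Hc. apply cos_near_nat_PI in Hc. fold m M in Hc.
      unfold f'. rewrite Rabs_mult, Rabs_Ropp, (Rabs_right M) by lra.
      rewrite Rmult_comm. apply Rmult_le_compat_l; lra. }
    intros E. assert (E' : slope f x (f' x) t = - q t) by lra.
    rewrite E', Rabs_Ropp in Hs. lra.
Qed.

Lemma height_zero_exists n j :
  contained (Ival (16 + n) j) range ->
  exists x, Ival (16 + n) j x /\ height (31 + 2 * n) x = 0.
Proof.
  intros Hc. pose proof (INR_weight_pos n) as HM.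
  set (m := (31 + 2 * n)%nat) in *. set (h := height m). set (M := INR m) in *.
  destruct (gap_bounds n) as [[Hg1 Hg2] _]. pose proof (gap_lt_PI2 n) as Hg3.
  pose proof PI_gt_3_1 as HPI.
  set (lo := 2 / M * (INR j * PI - gap n)). set (hi := 2 / M * (INR j * PI + gap n)).
  assert (H2M : 0 < 2 / M) by (apply Rdiv_lt_0_compat; lra).
  assert (HI : forall t, lo < t < hi -> Ival (16 + n) j t).
  { intros t [H1 H2]. apply Ival_iff. fold m M.
    assert (E : t = 2 / M * (M * (t / 2))) by (field; lra).
    set (y := M * (t / 2)) in *. rewrite E in H1, H2. unfold lo, hi in *.
    apply Rmult_lt_reg_l in H1; [|easy]. apply Rmult_lt_reg_l in H2; [|easy].
    apply Rabs_def1; lra. }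
  assert (Hlohi : lo < hi) by (apply Rmult_lt_compat_l; lra).
  (* Only the open interval is known to lie in [range]; a point of it beyond the range would exist
     if an end point were outside. *)
  assert (Hlo : inner lo /\ inner hi).
  { assert (Hr : forall t, lo < t < hi -> PI / 10 <= t <= 9 * PI / 10).
    { intros t Ht. apply Hc, HI, Ht. }
    assert (PI / 10 <= lo).
    { apply Rnot_lt_le. intros Hlt.
      specialize (Hr ((lo + Rmin hi (PI / 10)) / 2)).
      unfold Rmin in Hr. destruct (Rle_dec hi (PI / 10)); lra. }
    assert (hi <= 9 * PI / 10).
    { apply Rnot_lt_le. intros Hlt.
      specialize (Hr ((hi + Rmax lo (9 * PI / 10)) / 2)).
      unfold Rmax in Hr. destruct (Rle_dec lo (9 * PI / 10)); lra. }
    split; apply range_inner; unfold range; lra. }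
  destruct Hlo as [Hlo Hhi].
  assert (Hin : forall t, lo <= t <= hi -> inner t).
  { unfold inner in *. intros; lra. }
  (* [s = -1] selects [lo] and [s = 1] selects [hi]. The main term dominates there, so the sign of
     [h] is that of [- (-1) ^ j * s]. *)
  assert (Hval : forall s, Rabs s = 1 -> inner (2 / M * (INR j * PI + s * gap n)) ->
    exists w, h (2 / M * (INR j * PI + s * gap n)) = - (-1) ^ j * s * w /\ 0 < w).
  { intros s Hs Ht. set (t := 2 / M * (INR j * PI + s * gap n)) in *.
    assert (Ey : M * (t / 2) = s * gap n + INR j * PI) by (unfold t; field; lra).
    assert (Hsg : sin (s * gap n) = s * sin (gap n)).
    { unfold Rabs in Hs. destruct (Rcase_abs s).
      - replace s with (-1) by lra. replace (-1 * gap n) with (- gap n) by ring.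
        rewrite sin_neg. ring.
      - rewrite Hs. now rewrite !Rmult_1_l. }
    pose proof (remainder_lt n t Ht) as HR. fold m in HR.
    assert (Hss : s * s = 1).
    { unfold Rabs in Hs. destruct (Rcase_abs s); nra. }
    assert (Hjj : (-1) ^ j * (-1) ^ j = 1).
    { rewrite <- Rpow_mult_distr. replace (-1 * -1) with 1 by ring. apply pow1. }
    set (e := (-1) ^ j) in *.
    exists (2 * sin (gap n) - e * s * remainder m t). split.
    - unfold h, height. fold M. rewrite Ey, sin_add_nat_PI, Hsg. fold e.
      transitivity (-2 * (e * (s * sin (gap n))) +
        (e * e) * (s * s) * remainder m t).
      + rewrite Hss, Hjj. ring.
      + ring.
    - assert (Rabs (e * s * remainder m t) < 2 * sin (gap n)).
      { rewrite !Rabs_mult, Hs. unfold e. rewrite pow_1_abs. lra. }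
      apply Rabs_def2 in H. lra. }
  destruct (Hval (-1)) as [w1 [E1 W1]].
  { rewrite Rabs_left; lra. }
  { replace (INR j * PI + -1 * gap n) with (INR j * PI - gap n) by ring. exact Hlo. }
  replace (INR j * PI + -1 * gap n) with (INR j * PI - gap n) in E1 by ring.
  fold lo in E1.
  destruct (Hval 1) as [w2 [E2 W2]].
  { apply Rabs_R1. }
  { rewrite Rmult_1_l. exact Hhi. }
  rewrite Rmult_1_l in E2. fold hi in E2.
  set (f := fun t => - (-1) ^ j * h t).
  assert (Hjj : (-1) ^ j * (-1) ^ j = 1).
  { rewrite <- Rpow_mult_distr. replace (-1 * -1) with 1 by ring. apply pow1. }
  assert (F1 : f lo < 0).
  { unfold f. rewrite E1. replace (_ * _) with (- ((-1) ^ j * (-1) ^ j) * w1) by ring.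
    rewrite Hjj. lra. }
  assert (F2 : 0 < f hi).
  { unfold f. rewrite E2. replace (_ * _) with ((-1) ^ j * (-1) ^ j * w2) by ring.
    rewrite Hjj. lra. }
  assert (Hcont : forall t, lo <= t <= hi -> continuity_pt f t).
  { intros t Ht. apply continuity_pt_filterlim.
    apply (continuous_scal_r (- (-1) ^ j) h).
    apply (continuous_plus (fun t => - 2 * sin (M * (t / 2))) (remainder m)).
    - apply (ex_derive_continuous (K := R_AbsRing) (V := R_NormedModule)).
      eexists. apply main_term_derive.
    - apply continuous_remainder. now apply Hin. }
  destruct (IVT_interv f lo hi Hcont Hlohi F1 F2) as [x [Hx1 Hx2]].
  exists x. split.
  - apply HI. destruct Hx1 as [[Ha|Ha] [Hb|Hb]]; subst; lra.
  - unfold f in Hx2. apply Rmult_integral in Hx2. destruct Hx2 as [Hx2|]; [|easy].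
    assert ((-1) ^ j = 0) by lra. rewrite H in Hjj. lra.
Qed.

(** The cofactor [g] of [t - x] has no zero on the interval, which excludes a second zero and also
    makes the order at [x] equal to 1. *)
Lemma one_zero n j : contained (Ival (16 + n) j) range ->
  number_of_zeros (F (31 + 2 * n)) (Ival (16 + n) j) 1.
Proof.
  intros Hc. destruct (height_zero_exists n j Hc) as [x [Hx Hx0]].
  pose proof (range_inner _ (Hc x Hx)) as Hxi.
  destruct (height_slope n j x Hxi Hx) as [g [Hg1 [Hg2 Hg3]]].
  rewrite Hx0 in Hg2.
  exists ((x, 1%nat) :: nil). cbn [map fst snd list_sum fold_right].
  split; [repeat constructor; easy|]. split; [|split; [|easy]].
  - intros t. split.
    + intros [<-|[]]. split; [easy|]. rewrite F_height, Hx0 by easy. easy.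
    + intros [Ht Ht0]. left.
      pose proof (range_inner _ (Hc t Ht)) as Hti.
      rewrite F_height in Ht0 by easy. apply (f_equal snd) in Ht0.
      cbn [snd RtoC] in Ht0. specialize (Hg2 t Hti). rewrite Ht0 in Hg2.
      assert (Hz : (t - x) * g t = 0) by lra.
      apply Rmult_integral in Hz. destruct Hz as [Hz|Hz]; [lra|].
      now apply Hg3 in Hz.
  - intros y k [E|[]]. injection E as <- <-.
    (* On [inner], [F] is the imaginary unit times [height], and so is its cofactor. *)
    exists (fun t => (0, g t)). split; [|split].
    + apply filterlim_locally. intros eps.
      generalize (proj1 (filterlim_locally g (g x)) Hg1 eps).
      apply filter_imp. intros t Ht. split; [apply ball_center | exact Ht].
    + intros E. apply (f_equal snd) in E. now apply (Hg3 x).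
    + generalize (locally_inner x Hxi). apply filter_imp. intros t Ht.
      rewrite F_height by easy. specialize (Hg2 t Ht).
      rewrite Cpow_1_r.
      apply injective_projections; unfold RtoC, Cmult; cbn [fst snd]; lra.
Qed.

(** * Mutual position of the intervals *)

(* The unit of length in which the centres [alpha j k] and [alpha i (k + 1)]
   are [j (2 k + 1)] and [i (2 k - 1)], and the half-widths are [1] and less
   than [1]. *)
Definition spacing (k : nat) : R :=
  2 * PI / ((2 * INR k + 1) * (2 * INR k - 1)).

Lemma INR_gt_15 k : (15 < k)%nat -> 15 < INR k.
Proof. intros H. apply lt_INR in H. rewrite (INR_IZR_INZ 15) in H. exact H. Qed.

Lemma spacing_pos k : (15 < k)%nat -> 0 < spacing k.
Proof.
  intros Hk. apply INR_gt_15 in Hk. pose proof PI_RGT_0.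
  apply Rdiv_lt_0_compat; nra.
Qed.

(** The centre lies in [range]. The bounds keep away from 0 and [PI], where the families do overlap:
    both have centre 0 for index 0, and their last centres are one unit of [spacing k] apart. *)
Lemma contained_index_bounds k j : (15 < k)%nat -> contained (Ival k j) range ->
  (2 * k - 1 <= 20 * j)%nat /\ (20 * j <= 9 * (2 * k - 1))%nat.
Proof.
  intros Hk Hc.
  assert (Hr : range (alpha j k)).
  { apply Hc. unfold Ival. cbv zeta. fold (spacing k).
    pose proof (spacing_pos k Hk). lra. }
  assert (HM : INR (2 * k - 1) = 2 * INR k - 1).
  { rewrite minus_INR, mult_INR by lia. simpl. ring. }
  assert (Hpos : 0 < INR (2 * k - 1)) by (apply lt_0_INR; lia).
  unfold range, alpha in Hr. rewrite <- HM in Hr.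
  set (M := INR (2 * k - 1)) in *. pose proof PI_RGT_0 as HPI.
  destruct Hr as [H1 H2].
  assert (E : 2 * PI * INR j / M = PI * (2 * INR j / M)) by (field; lra).
  rewrite E in H1, H2.
  assert (H1' : 1 / 10 <= 2 * INR j / M).
  { apply (Rmult_le_reg_l PI); lra. }
  assert (H2' : 2 * INR j / M <= 9 / 10).
  { apply (Rmult_le_reg_l PI); lra. }
  apply (Rmult_le_compat_r M) in H1'; [|lra].
  apply (Rmult_le_compat_r M) in H2'; [|lra].
  replace (2 * INR j / M * M) with (2 * INR j) in H1', H2' by (field; lra).
  split; apply INR_le; rewrite mult_INR.
  - fold M. rewrite (INR_IZR_INZ 20). simpl IZR. lra.
  - rewrite (mult_INR 9). fold M. rewrite (INR_IZR_INZ 20), (INR_IZR_INZ 9).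
    simpl IZR. lra.
Qed.

Lemma Ival_spacing k j x : (15 < k)%nat -> Ival k j x ->
  spacing k * (INR (j * (2 * k + 1)) - 1) < x <
  spacing k * (INR (j * (2 * k + 1)) + 1).
Proof.
  intros Hk. pose proof (INR_gt_15 k Hk) as HK.
  unfold Ival, alpha. cbv zeta. fold (spacing k).
  rewrite mult_INR, plus_INR, mult_INR. change (INR 2) with 2. change (INR 1) with 1.
  set (K := INR k) in *.
  replace (2 * PI * INR j / (2 * K - 1)) with
    (spacing k * (INR j * (2 * K + 1))) by (unfold spacing; fold K; field; lra).
  lra.
Qed.

Lemma Ival_next_spacing k i x : (15 < k)%nat -> Ival (k + 1) i x ->
  spacing k * (INR (i * (2 * k - 1)) - 1) < x <
  spacing k * (INR (i * (2 * k - 1)) + 1).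
Proof.
  intros Hk. pose proof (INR_gt_15 k Hk) as HK. pose proof (spacing_pos k Hk) as Hu.
  unfold Ival, alpha. cbv zeta.
  rewrite mult_INR, minus_INR, mult_INR, plus_INR by lia.
  change (INR 2) with 2. change (INR 1) with 1.
  set (K := INR k) in *.
  replace (2 * PI * INR i / (2 * (K + 1) - 1)) with
    (spacing k * (INR i * (2 * K - 1))) by (unfold spacing; fold K; field; lra).
  replace (2 * PI / ((2 * (K + 1) + 1) * (2 * (K + 1) - 1))) with
    (spacing k * ((2 * K - 1) / (2 * K + 3))) by (unfold spacing; fold K; field; lra).
  assert (H1 : (2 * K - 1) / (2 * K + 3) < 1).
  { apply (Rmult_lt_reg_r (2 * K + 3)); [lra|].
    unfold Rdiv. rewrite Rmult_assoc, Rinv_l; lra. }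
  apply (Rmult_lt_compat_l (spacing k)) in H1; [lra | easy].
Qed.

(** Centres are integers in the unit [spacing k] and half-widths are at most 1, so a distance of 2
    suffices and the order becomes arithmetic of natural numbers. *)
Lemma left_of_spacing k (A B : R -> Prop) (a b : nat) : (15 < k)%nat ->
  (a + 2 <= b)%nat ->
  (forall x, A x -> x < spacing k * (INR a + 1)) ->
  (forall x, B x -> spacing k * (INR b - 1) < x) -> left_of A B.
Proof.
  intros Hk Hab HA HB x y Hx Hy. apply HA in Hx. apply HB in Hy.
  apply le_INR in Hab. rewrite plus_INR in Hab. change (INR 2) with 2 in Hab.
  pose proof (spacing_pos k Hk).
  assert (spacing k * (INR a + 1) <= spacing k * (INR b - 1))
    by (apply Rmult_le_compat_l; lra).
  lra.
Qed.

Lemma Ival_left_of_same k j j' : (15 < k)%nat -> (j < j')%nat ->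
  left_of (Ival k j) (Ival k j').
Proof.
  intros Hk Hj. apply (left_of_spacing k _ _ (j * (2 * k + 1)) (j' * (2 * k + 1)));
    [easy | nia | |]; intros x Hx; now apply Ival_spacing in Hx.
Qed.

Lemma Ival_left_of_next k j i : (15 < k)%nat ->
  (j * (2 * k + 1) + 2 <= i * (2 * k - 1))%nat ->
  left_of (Ival k j) (Ival (k + 1) i).
Proof.
  intros Hk Hj. apply (left_of_spacing k _ _ _ _ Hk Hj); intros x Hx.
  - now apply Ival_spacing in Hx.
  - now apply Ival_next_spacing in Hx.
Qed.

Lemma Ival_next_left_of k j i : (15 < k)%nat ->
  (i * (2 * k - 1) + 2 <= j * (2 * k + 1))%nat ->
  left_of (Ival (k + 1) i) (Ival k j).
Proof.
  intros Hk Hj. apply (left_of_spacing k _ _ _ _ Hk Hj); intros x Hx.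
  - now apply Ival_next_spacing in Hx.
  - now apply Ival_spacing in Hx.
Qed.

Lemma left_of_disjoint (A B : R -> Prop) : left_of A B -> disjoint A B.
Proof. intros H x [Ha Hb]. specialize (H x x Ha Hb). lra. Qed.

Lemma disjoint_sym (A B : R -> Prop) : disjoint A B -> disjoint B A.
Proof. intros H x [Ha Hb]. now apply (H x). Qed.

Lemma Ival_disjoint_same k j j' : (15 < k)%nat -> j <> j' ->
  disjoint (Ival k j) (Ival k j').
Proof.
  intros Hk Hj. destruct (Nat.lt_total j j') as [H|[H|H]]; [|easy|].
  - now apply left_of_disjoint, Ival_left_of_same.
  - now apply disjoint_sym, left_of_disjoint, Ival_left_of_same.
Qed.

(** If [j < i], the centres are at least [2 k - 1 - 2 j] units apart, otherwise at least [2 i]; the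
    index bounds make both at least 2. *)
Lemma Ival_disjoint_next k j i : (15 < k)%nat ->
  contained (Ival k j) range -> contained (Ival (k + 1) i) range ->
  disjoint (Ival k j) (Ival (k + 1) i).
Proof.
  intros Hk Hj Hi.
  apply contained_index_bounds in Hj; [|lia].
  apply contained_index_bounds in Hi; [|lia].
  destruct (Nat.lt_ge_cases j i) as [H|H].
  - apply left_of_disjoint, Ival_left_of_next; [easy|].
    apply Nat.le_trans with ((j + 1) * (2 * k - 1))%nat; [nia|].
    apply Nat.mul_le_mono_r. lia.
  - apply disjoint_sym, left_of_disjoint, Ival_next_left_of; [easy|].
    apply Nat.le_trans with (i * (2 * k + 1))%nat; [nia|].
    apply Nat.mul_le_mono_r. lia.
Qed.

Lemma zeros_located k theta : (15 < k)%nat -> range theta ->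
  F (2 * k - 1) theta = RtoC 0 -> Iunion k theta.
Proof.
  intros Hk. replace (2 * k - 1)%nat with (31 + 2 * (k - 16))%nat by lia.
  replace k with (16 + (k - 16))%nat at 2 by lia. apply F_zero_located.
Qed.

Lemma odd_number_of_zeros k j : (15 < k)%nat -> contained (Ival k j) range ->
  exists N : nat, Nat.Odd N /\ number_of_zeros (F (2 * k - 1)) (Ival k j) N.
Proof.
  intros Hk Hc. exists 1%nat. split; [now exists 0%nat|].
  replace (2 * k - 1)%nat with (31 + 2 * (k - 16))%nat by lia.
  replace k with (16 + (k - 16))%nat in * by lia.
  replace (16 + (k - 16) - 16)%nat with (k - 16)%nat by lia.
  now apply one_zero.
Qed.

Theorem theorem1p2 (k : nat) (hk : (15 < k)%nat) :
  (* location of the zeros *)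
  (forall theta : R, range theta ->
     F (2 * k - 1) theta = RtoC 0 -> Iunion k theta) /\
  (forall theta : R, range theta ->
     F (2 * k + 1) theta = RtoC 0 -> Iunion (k + 1) theta) /\
  (* odd number of zeros in each interval *)
  (forall j : nat, (j < k)%nat -> contained (Ival k j) range ->
     exists N : nat, Nat.Odd N /\
       number_of_zeros (F (2 * k - 1)) (Ival k j) N) /\
  (forall j : nat, (j < k + 1)%nat -> contained (Ival (k + 1) j) range ->
     exists N : nat, Nat.Odd N /\
       number_of_zeros (F (2 * k + 1)) (Ival (k + 1) j) N) /\
  (* pairwise disjointness *)
  (forall j j' : nat, (j < k)%nat -> (j' < k)%nat -> j <> j' ->
     contained (Ival k j) range -> contained (Ival k j') range ->
     disjoint (Ival k j) (Ival k j')) /\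
  (forall i i' : nat, (i < k + 1)%nat -> (i' < k + 1)%nat -> i <> i' ->
     contained (Ival (k + 1) i) range -> contained (Ival (k + 1) i') range ->
     disjoint (Ival (k + 1) i) (Ival (k + 1) i')) /\
  (forall j i : nat, (j < k)%nat -> (i < k + 1)%nat ->
     contained (Ival k j) range -> contained (Ival (k + 1) i) range ->
     disjoint (Ival k j) (Ival (k + 1) i)) /\
  (* separation *)
  (forall j j' : nat, (j < j')%nat -> (j' < k)%nat ->
     contained (Ival k j) range -> contained (Ival k j') range ->
     exists i : nat, (i < k + 1)%nat /\
       left_of (Ival k j) (Ival (k + 1) i) /\
       left_of (Ival (k + 1) i) (Ival k j')).
Proof.
  assert (hk' : (15 < k + 1)%nat) by lia.
  assert (Em : (2 * k + 1)%nat = (2 * (k + 1) - 1)%nat) by lia.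
  rewrite Em. repeat split.
  - intros theta. now apply zeros_located.
  - intros theta. now apply zeros_located.
  - intros j _. now apply odd_number_of_zeros.
  - intros j _. now apply odd_number_of_zeros.
  - intros j j' _ _ Hj _ _. now apply Ival_disjoint_same.
  - intros j j' _ _ Hj _ _. now apply Ival_disjoint_same.
  - intros j i _ _. now apply Ival_disjoint_next.
  (* The centre [(j + 1) (2 k - 1)] exceeds [j (2 k + 1)] by [2 k - 1 - 2 j] and lies [2 (j + 1)]
     below [(j + 1) (2 k + 1)], which is at most [j' (2 k + 1)]. *)
  - intros j j' Hjj Hj' Hj _. exists (j + 1)%nat.
    apply contained_index_bounds in Hj; [|easy].
    split; [lia|]. split.
    + apply Ival_left_of_next; [easy | nia].
    + apply Ival_next_left_of; [easy|].
      apply Nat.le_trans with ((j + 1) * (2 * k + 1))%nat; [nia|].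
      apply Nat.mul_le_mono_r. lia.
Qed.
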